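(* Let $m\ge 1$. Suppose $X=\prod_{\sigma\in S}X_\sigma$ is a Besicovitch metric space, $\mu=\prod_{\sigma\in S}\mu_\sigma$ is a Federer measure on $X$, and $\mathbf f:X\to K_S^m$, $\mathbf f(x)=(\mathbf f_\sigma(x^\sigma))_{\sigma\in S}$ for $x=(x^\sigma)_{\sigma\in S}$, is a continuous map such that $(\mathbf f,\mu)$ is nonplanar at $\mu$-almost every point of $X$ and, for each $\sigma\in S$, $(\mathbf f_\sigma,\mu_\sigma)$ is good at $\mu_\sigma$-almost every point of $X_\sigma$. Then $\mathbf f_\star\mu(Sing_S^m)=0$, where $\mathbf f_\star\mu$ is the pushforward measure.
   Context: $K$ is a totally real number field of degree $d$ over $\mathbb Q$ with ring of integers $\mathcal O_K$; $S$ is the set of its $d$ archimedean places, identified with the embeddings $\sigma:K\to\mathbb R$. For $\sigma\in S$, $K_\sigma\cong\mathbb R$ is the completion of $\sigma(K)$, and $K_S=\prod_{\sigma\in S}K_\sigma$. $K$ is embedded diagonally in $K_S$ by $\alpha\mapsto(\sigma(\alpha))_{\sigma\in S}$ and identified with its image; similarly $K^m\subset K_S^m\simeq\prod_{\sigma}K_\sigma^m$. For $x=(x^\sigma)\in K_S$, $\|x\|=\max_\sigma|x^\sigma|$; for $\mathbf x=(x_1,\dots,x_m)\in K_S^m$, $\|\mathbf x\|=\max_j\|x_j\|$. For $\mathbf q\in\mathcal O_K^m$, $\mathbf q\cdot\mathbf x=\sum_j q_jx_j\in K_S$. Singular vectors: $\mathbf x\in K_S^m$ is singular if for every $c>0$,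 for all sufficiently large $Q>0$ there exist $\mathbf 0\ne\mathbf q\in\mathcal O_K^m$ and $q_0\in\mathcal O_K$ with $\|\mathbf q\cdot\mathbf x+q_0\|<c/Q^m$ and $\|\mathbf q\|\le Q$. $Sing_S^m$ denotes the set of singular vectors in $K_S^m$. Each $X_\sigma$ is a metric space with a measure $\mu_\sigma$, and $X$ carries the product (sup) metric. $\mathbf f_\sigma=(f_{1,\sigma},\dots,f_{m,\sigma}):X_\sigma\to K_\sigma^m$. Besicovitch: a metric space $X$ is Besicovitch if there is a constant $N_X$ such that for any bounded $A\subset X$ and any family $\mathcal B$ of nonempty open balls such that every $x\in A$ is a center of some ball in $\mathcal B$, there is a finite or countable subfamily $\{B_i\}\subset\mathcal B$ with $1_A\le\sum_i1_{B_i}\le N_X$. Federer: a Radon measure $\mu$ on $X$ is $D$-Federer on an open set $U$ with $\mu(U)>0$ if $\sup \frac{\mu(B(x,3r))}{\mu(B(x,r))}<D$, the sup being over $x\in\operatorname{supp}\mu$, $r>0$ with $B(x,3r)\subset U$. $\mu$ is Federer if for $\mu$-a.e. $x\in X$ there are a neighbourhood $U$ of $x$ and $D>0$ such that $\mu$ is $D$-Federer on $U$. Nonplanar: $(\mathbf f,\mu)$ is nonplanar at $x_0=(x_0^\sigma)\in X$ if for any neighbourhood $B=\prod_\sigma B_\sigma$ of $x_0$ and all $\sigma\in S$, the restrictions of $1,f_{1,\sigma},\dots,f_{m,\sigma}$ to $B_\sigma\cap\operatorname{supp}\mu_\sigma$ are linearly independent over $\mathbb R$. Good: for a metric space $Y$,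 Borel measure $\nu$ on $Y$, $U\subset Y$ and $C,\alpha>0$, a Borel function $f:U\to\mathbb R$ is $(C,\alpha)$-good on $U$ with respect to $\nu$ if for any open ball $B\subset U$ centered in $\operatorname{supp}\nu$ and any $\varepsilon>0$, $\nu(\{x\in B:|f(x)|<\varepsilon\})\le C\left(\frac{\varepsilon}{\|f\|_{\nu,B}}\right)^\alpha\nu(B)$, where $\|f\|_{\nu,B}=\sup\{c:\nu(\{x\in B:|f(x)|>c\})>0\}$. For $\mathbf g=(g_1,\dots,g_n):Y\to\mathbb R^n$, $(\mathbf g,\nu)$ is good at $y_0\in Y$ if there are a neighbourhood $V$ of $y_0$ and $C,\alpha>0$ such that every (real) linear combination of $1,g_1,\dots,g_n$ is $(C,\alpha)$-good on $V$ with respect to $\nu$. *)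

(* Defs.v *)
From HB Require Import structures.
From mathcomp Require Import all_boot all_order all_algebra all_field.
From mathcomp Require Import complex.
From mathcomp Require Import all_classical all_reals all_analysis.

Set Implicit Arguments.
Unset Strict Implicit.
Unset Printing Implicit Defensive.

Import Order.TTheory GRing.Theory Num.Theory.
Import numFieldNormedType.Exports.

Local Open Scope classical_set_scope.
Local Open Scope ring_scope.

(* `measurableType`s are pointed in MathComp-Analysis, so the metric spaces
   that carry measures are assumed nonempty. *)
#[short(type="pmetricType")]
HB.structure Definition PointedMetric (R : numDomainType) :=
  {T of Metric R T & Pointed T}.

Notation borel T := (g_sigma_algebraType (@open T)).

(* A new name is needed for the dependent product: the library's pseudometric
   on [forall i, X i] is not the sup metric. *)
Definition sup_prod (R : realType) (I : finType) (X : I -> pmetricType R) :=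
  forall i, X i.

Section sup_prod_metric.
Context {R : realType} {I : finType} (X : I -> pmetricType R).

Definition sup_dist (x y : sup_prod X) : R :=
  \big[Num.max/0]_(i : I) mdist (x i) (y i).

Local Lemma sup_distP (x y : sup_prod X) (e : R) :
  sup_dist x y <= e <-> 0 <= e /\ forall i, mdist (x i) (y i) <= e.
Proof.
split=> [/bigmax_leP[e0 xye]|[e0 xye]].
  by split=> // i; exact: xye.
by apply/bigmax_leP; split=> // i _; exact: xye.
Qed.

Local Lemma sup_dist_comp (x y : sup_prod X) i :
  mdist (x i) (y i) <= sup_dist x y.
Proof. exact: le_bigmax. Qed.

Local Lemma sup_distxx (x : sup_prod X) : sup_dist x x = 0.
Proof.
apply/le_anti/andP; split; last exact: bigmax_ge_id.
by apply/sup_distP; split=> // i; rewrite mdistxx.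
Qed.

Local Lemma sup_dist_positivity (x y : sup_prod X) : sup_dist x y = 0 -> x = y.
Proof.
move=> xy0; apply: functional_extensionality_dep => i.
apply: mdist_positivity; apply/le_anti; rewrite mdist_ge0 andbT -xy0.
exact: sup_dist_comp.
Qed.

Local Lemma sup_dist_sym (x y : sup_prod X) : sup_dist x y = sup_dist y x.
Proof. by apply: eq_bigr => i _; rewrite metric_sym. Qed.

Local Lemma sup_dist_triangle (y x z : sup_prod X) :
  sup_dist x z <= sup_dist x y + sup_dist y z.
Proof.
apply/sup_distP; split; first by rewrite addr_ge0// bigmax_ge_id.
move=> i; rewrite (le_trans (metric_triangle _ (y i) _))//.
by rewrite lerD// sup_dist_comp.
Qed.

HB.instance Definition _ := Pointed.copy (sup_prod X) (forall i, X i).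
HB.instance Definition _ := isMetric.Build R (sup_prod X)
  sup_distxx sup_dist_positivity sup_dist_sym sup_dist_triangle.

End sup_prod_metric.

(* On separable metric spaces the Borel sets of the product form the product
   sigma-algebra, so that for sigma-finite [mu_ i] this determines [mu]. *)
Definition is_product_measure {R : realType} {I : finType}
    (X : I -> pmetricType R) (mu_ : forall i, {measure set borel (X i) -> \bar R})
    (mu : {measure set borel (sup_prod X) -> \bar R}) : Prop :=
  forall A : forall i, set (borel (X i)), (forall i, measurable (A i)) ->
    (mu [set x | forall i, A i (x i)] = \prod_(i : I) mu_ i (A i))%E.

Definition metric_bounded {R : realType} (T : metricType R) (A : set T) : Prop :=
  exists M : R, forall x y, A x -> A y -> mdist x y <= M.

Definition besicovitch {R : realType} (T : metricType R) : Prop :=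
  exists N : R, forall (A : set T) (F : set (set T)),
    metric_bounded A ->
    (forall B, F B -> exists x, exists2 r : R, 0 < r & B = ball x r) ->
    (forall x, A x -> exists2 r : R, 0 < r & F (ball x r)) ->
    exists G : set (set T), [/\ G `<=` F, countable G &
      forall x, ((\1_A x : R)%:E <= \esum_(B in G) (\1_B x : R)%:E)%E /\
                (\esum_(B in G) (\1_B x : R)%:E <= N%:E)%E].

Section metric_measure.
Context {R : realType} {T : pmetricType R}.
Implicit Types (mu nu : {measure set borel T -> \bar R}) (A U V : set T).

Definition supp mu : set T :=
  [set x | forall U, open_nbhs x U -> (0 < mu U)%E].

Definition radon mu : Prop :=
  (forall x : T, exists2 U, open_nbhs x U & (mu U < +oo)%E) /\
  (forall A : set (borel T), measurable A ->
    mu A = ereal_sup [set mu C | C in [set C : set T | compact C /\ C `<=` A]]).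

(* The denominators are positive since [p.1] is in the support. *)
Definition federer_on (D : R) mu U : Prop :=
  let ratio (x : T) (r : R) := (mu (ball x (3 * r)%R) / mu (ball x r))%E in
  [/\ open U, (0 < mu U)%E &
    (ereal_sup [set ratio p.1 p.2 | p in
       [set p : T * R | [/\ supp mu p.1, (0 < p.2)%R &
                            ball p.1 (3 * p.2)%R `<=` U]]] < D%:E)%E].

Definition federer mu : Prop :=
  radon mu /\
  {ae mu, forall x, exists U, exists2 D : R,
    0 < D & open_nbhs x U /\ federer_on D mu U}.

Definition norm_on nu U (f : T -> R) : \bar R :=
  ereal_sup [set c%:E | c in [set c : R |
    (0 < nu (U `&` [set x | (c < `|f x|)%R]))%E]].

(* Extended-real division: the quotient is [+oo] when [f] vanishes almost
   everywhere on the ball, and [0] when [f] is essentially unbounded there. *)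
Definition good_on (C alpha : R) nu U (f : T -> R) : Prop :=
  measurable_fun (U : set (borel T)) (f : borel T -> R) /\
  forall (x : T) (r : R), supp nu x -> 0 < r -> ball x r `<=` U ->
  forall eps : R, 0 < eps ->
    (nu (ball x r `&` [set y | (`|f y| < eps)%R])
     <= C%:E * (eps%:E / norm_on nu (ball x r) f) `^ alpha * nu (ball x r))%E.

Definition affine_comb n (g : T -> 'rV[R]_n) (a0 : R) (a : 'rV[R]_n) : T -> R :=
  fun y => a0 + \sum_(j < n) a 0 j * g y 0 j.

Definition good_at n (g : T -> 'rV[R]_n) nu (y0 : T) : Prop :=
  exists2 V, open_nbhs y0 V & exists C alpha : R, [/\ 0 < C, 0 < alpha &
    forall a0 a, good_on C alpha nu V (affine_comb g a0 a)].

Definition indep_with_1_on n (g : T -> 'rV[R]_n) A : Prop :=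
  forall a0 a, (forall y, A y -> affine_comb g a0 a y = 0) -> a0 = 0 /\ a = 0.

End metric_measure.

Definition nonplanar_at {R : realType} {I : finType} (X : I -> pmetricType R)
    (mu_ : forall i, {measure set borel (X i) -> \bar R}) n
    (f_ : forall i, X i -> 'rV[R]_n) (x0 : sup_prod X) : Prop :=
  forall B : forall i, set (X i),
    nbhs x0 [set x : sup_prod X | forall i, B i (x i)] ->
    forall i, indep_with_1_on (f_ i) (B i `&` supp (mu_ i)).

Definition totally_real (R : realType) (K : fieldExtType rat) : Prop :=
  forall (tau : {rmorphism K -> R[i]}) (x : K), tau x \is Num.real.

Definition enum_real_embeddings (R : realType) (K : fieldExtType rat) d
    (sigma : 'I_d -> {rmorphism K -> R}) : Prop :=
  (forall s t, sigma s =1 sigma t -> s = t) /\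
  (forall tau : {rmorphism K -> R}, exists s, tau =1 sigma s).

Definition in_OK (K : fieldExtType rat) (x : K) : Prop :=
  integralOver (intr : int -> K) x.

(* [K_S] is ['cV[R]_d] and [K_S^m] is ['M[R]_(d, m)]: the row [s] of a matrix is
   its component in [K_s^m] and the column [j] its [j]-th coordinate in [K_S].
   The library norm of matrices is the maximum of the absolute values of the
   entries. *)
Section singular.
Context {R : realType} {K : fieldExtType rat} {d m : nat}.
Variable sigma : 'I_d -> {rmorphism K -> R}.

Definition embed n (q : 'rV[K]_n) : 'M[R]_(d, n) :=
  \matrix_(s, j) sigma s (q 0 j).

Definition dotKS n (y x : 'M[R]_(d, n)) : 'cV[R]_d :=
  \col_s \sum_(j < n) y s j * x s j.

Definition singular (x : 'M[R]_(d, m)) : Prop :=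
  forall c : R, 0 < c -> \forall Q \near +oo,
    exists (q : 'rV[K]_m) (q0 : K),
      [/\ q != 0, (forall j, in_OK (q 0 j)), in_OK q0,
          `| dotKS (embed q) x + embed q0%:M | < c / Q ^+ m &
          `| embed q | <= Q].

Definition Sing : set 'M[R]_(d, m) := [set x | singular x].

End singular.

(* Main.v *)
(* The proof combines the Dani correspondence with the Kleinbock-Margulis
   quantitative nondivergence method.  Let [H_(Q,x)] be the unipotent matrix of
   [x] followed by [diag(Q^m, 1/Q, ..., 1/Q)] on each factor [K_s^(m+1)].  If [x]
   is singular, then for every [delta > 0] and all large [Q] some nonzero vector
   [(q0, q)] over [O_K] is sent by [H_(Q,x)] to a vector of norm at most [delta].

   To a subspace of [K^(m+1)] attach the function of [x] given by the least
   covolume [prod_s |sigma_s(w) H_(Q,x)|] of a wedge product [w] of independent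
   integral vectors of that subspace.  Two such [w] differ by a factor in [K], so
   the minimizing [w] does not depend on [x] or [Q]; and, as [w] has integral
   coordinates and the norm of a nonzero integer is at least 1 in absolute value,
   [prod_s |sigma_s(w)| >= 1].
   Coordinates of [w H_(Q,x)] are affine in each component of [x], hence these
   functions are good, and nonplanarity bounds their suprema on a ball below by
   some [rho] independent of the subspace and of [Q >= 1].

   By the nondivergence theorem, outside a set of measure [O(c(eta)) mu(B)] with
   [c(eta) -> 0], every [x] in the ball [B] admits a flag on which covolumes lie
   between [rho eta^d] and [rho] and relative to which all others are at least
   [rho].  Adjoining an integral vector [v] to the largest member of the flag not
   containing it multiplies the covolume by [O(prod_s |v H_(Q,x)|)], so at these
   points no integral vector is short.  Letting [Q] go to infinity and then [eta]
   to 0, singular vectors have measure 0 in [B]. *)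
Require Import Defs.
From HB Require Import structures.
From mathcomp Require Import all_boot all_order all_algebra all_field.
From mathcomp Require Import complex finmap.
From mathcomp Require Import all_classical all_reals all_analysis.
From mathcomp Require Import measurable_realfun.
From mathcomp Require Import ring lra zify.

Set Implicit Arguments.
Unset Strict Implicit.
Unset Printing Implicit Defensive.

Import Order.TTheory GRing.Theory Num.Theory.
Import numFieldNormedType.Exports.

Local Open Scope classical_set_scope.
Local Open Scope ring_scope.

(** * Norms of algebraic integers *)

Section embeddings.
Context {R : realType} {K : fieldExtType rat} {d : nat}.
Variable sigma : 'I_d -> {rmorphism K -> R}.
Hypothesis sigma_inj : forall s t, sigma s =1 sigma t -> s = t.

(** Artin's argument: subtracting [sigma t y] times the relation at [x] from the relation at [y * x]
    kills the coefficient of [t], so induction on the number of nonzero coefficients applies. *)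
Lemma embeddings_independent (c : 'I_d -> R) :
  (forall x, \sum_s c s * sigma s x = 0) -> forall s, c s = 0.
Proof.
have [n] := ubnP #|[pred s | c s != 0]|; elim: n c => // n IH c.
rewrite ltnS => cn c0 t; apply/eqP/negPn/negP => ct0.
suff c'0 s : s != t -> c s = 0.
  have := c0 1; rewrite (bigD1 t)//= rmorph1 mulr1 big1 ?addr0.
    by move=> ct; rewrite ct eqxx in ct0.
  by move=> s st; rewrite c'0// mul0r.
move=> st; have /existsNP[y /eqP yst] : ~ (sigma s =1 sigma t).
  by move=> /sigma_inj/eqP; rewrite (negPf st).
have := IH (fun u => c u * (sigma u y - sigma t y)).
move=> IHc; have /eqP : c s * (sigma s y - sigma t y) = 0; [apply: IHc|].
- apply: leq_trans cn; apply: proper_card; apply/properP; split.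
    apply/fintype.subsetP => u; rewrite !inE; apply: contra => /eqP->.
    by rewrite mul0r.
  by exists t; rewrite !inE ?subrr ?mulr0 ?eqxx.
- move=> x; transitivity (\sum_u c u * sigma u (y * x) -
                           sigma t y * \sum_u c u * sigma u x).
    rewrite mulr_sumr -sumrB; apply: eq_bigr => u _.
    by rewrite rmorphM mulrBr mulrBl !mulrA [sigma t y * _]mulrC.
  by rewrite !c0 mulr0 subrr.
- by rewrite mulf_eq0 subr_eq0 (negPf yst) orbF => /eqP.
Qed.

End embeddings.

Lemma integral_rat_int (q : rat) :
  integralOver (intr : int -> rat) q -> q \is a Num.int.
Proof.
move=> [p p_mon pq].
have qA : ratr q \in Aint.
  apply: (@root_monic_Aint (map_poly intr p)).
  - have := rmorph_root (ratr : {rmorphism rat -> algC}) pq.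
    by rewrite -map_poly_comp (eq_map_poly (g := intr))// => z /=; rewrite ratr_int.
  - by rewrite monic_map.
  - by apply/polyOverP => i; rewrite coef_map/= rpred_int.
have /intrP[z qz] := Cint_rat_Aint (Crat_rat q) qA.
have -> : q = z%:~R.
  apply: (fmorph_inj (ratr : {rmorphism rat -> algC})).
  by rewrite [LHS]qz /= ratr_int.
exact: rpred_int.
Qed.

Lemma prod_embeddings_rat {R : realType} {K : fieldExtType rat}
    (sigma : 'I_(\dim {:K}) -> {rmorphism K -> R}) :
  (forall s t, sigma s =1 sigma t -> s = t) ->
  forall a, exists q : rat, \prod_s sigma s a = ratr q.
Proof.
move=> sigma_inj a; pose b := vbasis {:K}.
have bE x : x = \sum_i coord b i x *: b`_i by apply: coord_vbasis; rewrite memvf.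
(* [W M^T W^-1] is the diagonal matrix of the [sigma s a], where [M] is the
   matrix of multiplication by [a]. *)
pose W : 'M[R]_(\dim {:K}) := \matrix_(s, k) sigma s b`_k.
pose M : 'M[rat]_(\dim {:K}) := \matrix_(k, l) coord b l (a * b`_k).
(* A kernel vector of [W] would be a linear relation between the embeddings, as a relation on a
   basis extends by rational linearity. *)
have W_unit : \det W != 0.
  apply/negP => /det0P[c c0 cW]; move/negP: c0; apply.
  apply/eqP/rowP => s; rewrite mxE; move: s.
  apply: embeddings_independent sigma_inj _ _ => x; rewrite {1}[x]bE.
  under eq_bigr do rewrite rmorph_sum mulr_sumr.
  rewrite exchange_big big1//= => k _.
  transitivity (ratr (coord b k x) * (c *m W) 0 k); last by rewrite cW mxE mulr0.
  rewrite mxE mulr_sumr; apply: eq_bigr => s _.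
  by rewrite rmorphZ_num mxE mulrCA.
exists (\det M); rewrite -det_map_mx -[RHS]det_tr.
apply: (mulIf W_unit).
have <- : \det (diag_mx (\row_s sigma s a)) = \prod_s sigma s a.
  by rewrite det_diag; apply: eq_bigr => s _; rewrite mxE.
rewrite -det_mulmx [RHS]mulrC -det_mulmx; congr (\det _).
apply/matrixP => s k; rewrite mul_diag_mx !mxE -rmorphM/= {1}[a * _]bE.
rewrite rmorph_sum; apply: eq_bigr => l _.
by rewrite rmorphZ_num !mxE mulrC.
Qed.

(** The product is, up to sign, the norm of [a]: rational by the previous lemma, integral as a
    product of images of an integral element, hence a nonzero integer. *)
Lemma prod_embeddings_natE {R : realType} {K : fieldExtType rat} d
    (sigma : 'I_d -> {rmorphism K -> R}) :
  \dim {:K} = d -> (forall s t, sigma s =1 sigma t -> s = t) ->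
  forall a, in_OK a -> a != 0 ->
  exists2 N : nat, (0 < N)%N & \prod_s `|sigma s a| = N%:R.
Proof.
move=> dimK; case: d / dimK sigma => sigma sigma_inj a aO a0.
have [q sq] := prod_embeddings_rat sigma_inj a.
have sO : integralOver (intr : int -> R) (\prod_s sigma s a).
  elim/big_ind : _ => [||s _]; [exact: integral1|exact: integral_mul|].
  case: aO => p p_mon /(rmorph_root (sigma s)) pa; exists p => //.
  rewrite -map_poly_comp (eq_map_poly (g := intr)) in pa => // z.
  by rewrite /= rmorph_int.
have /integral_rat_int/intrP[z qz] : integralOver (intr : int -> rat) q.
  case: sO => p p_mon; rewrite sq => pq; exists p => //.
  rewrite -(fmorph_root (ratr : {rmorphism rat -> R})) -map_poly_comp.
  by rewrite (eq_map_poly (g := intr)) => // x; rewrite /= ratr_int.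
exists `|z|%N; last first.
  by rewrite -normr_prod sq qz ratr_int natr_absz intr_norm.
rewrite absz_gt0; apply: contraTneq isT => z0; move: sq.
rewrite qz z0 ratr_int => /eqP; rewrite prodf_seq_eq0 => /hasP[s _ /=].
by rewrite fmorph_eq0 (negPf a0).
Qed.

(** * Minors of the flow *)

Section minors.
Context {R : realFieldType}.

(* The sup norm of the wedge product of the rows of [A].  Letting [g] range over
   all maps only repeats minors up to sign, or adds zeros. *)
Definition minor_norm j n (A : 'M[R]_(j, n)) : R :=
  \big[Num.max/0]_(g : {ffun 'I_j -> 'I_n}) `|\det (colsub g A)|.

Lemma minor_norm_ge0 j n (A : 'M[R]_(j, n)) : 0 <= minor_norm A.
Proof. exact: bigmax_ge_id. Qed.

Lemma minor_normP j n (A : 'M[R]_(j, n.+1)) :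
  exists g : {ffun 'I_j -> 'I_n.+1}, minor_norm A = `|\det (colsub g A)|.
Proof.
have [g _ ->] : {g : {ffun 'I_j -> 'I_n.+1} | g \in predT &
    minor_norm A = `|\det (colsub g A)|}.
  by apply: (eq_bigmax [ffun=> ord0]).
by exists g.
Qed.

Lemma le_minor_norm j n (A : 'M[R]_(j, n)) (g : 'I_j -> 'I_n) :
  `|\det (colsub g A)| <= minor_norm A.
Proof. by rewrite -mxsub_ffunr; apply: le_bigmax. Qed.

Lemma minor_norm0 n (A : 'M[R]_(0, n)) : minor_norm A <= 1.
Proof.
by apply/bigmax_leP; split=> // g _; rewrite det_mx00 normr1.
Qed.

Lemma minor_normM j n (C : 'M[R]_j) (A : 'M[R]_(j, n)) :
  minor_norm (C *m A) = `|\det C| * minor_norm A.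
Proof.
rewrite /minor_norm.
rewrite (big_morph _ (fun x y => maxr_pMr x y (normr_ge0 (\det C))) (mulr0 _)).
by apply: eq_bigr => g _; rewrite -mulmx_colsub det_mulmx normrM.
Qed.

(** Laplace expansion along the added row: each of the [j.+1] cofactors is, up to sign, a minor of
    [A]. *)
Lemma minor_norm_col_mx j n (v : 'rV[R]_n) (A : 'M[R]_(j, n)) (e : R) :
  0 <= e -> (forall l, `|v 0 l| <= e) ->
  minor_norm (col_mx v A) <= j.+1%:R * minor_norm A * e.
Proof.
move=> e0 ve; have A0 := minor_norm_ge0 A; apply/bigmax_leP; split=> [|g _].
  by rewrite !mulr_ge0.
rewrite (expand_det_row _ ord0) (le_trans (ler_norm_sum _ _ _))//.
have -> : j.+1%:R * minor_norm A * e = \sum_(k < j.+1) (e * minor_norm A).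
  by rewrite sumr_const card_ord -[RHS]mulr_natl -mulrA (mulrC e).
apply: ler_sum => k _; rewrite normrM ler_pM ?normr_ge0//.
  rewrite !mxE; case: splitP => [i _|i /= i0]; first by rewrite ord1 ve.
  by case: i i0.
rewrite /cofactor normrM normrX normrN1 expr1n mul1r.
have -> : row' ord0 (col' k (colsub g (col_mx v A)))
        = colsub (fun i => g (lift k i)) A.
  apply/matrixP => a b; rewrite !mxE; case: splitP => [i|i /=].
    by rewrite ord1.
  by rewrite /bump/= !add1n => -[] ai; congr (A _ _); apply: val_inj.
exact: le_minor_norm.
Qed.


Lemma det_colsub_non_inj j n (g : 'I_j -> 'I_n) (A : 'M[R]_(j, n)) i1 i2 :
  i1 != i2 -> g i1 = g i2 -> \det (colsub g A) = 0.
Proof.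
move=> i12 g12; rewrite -det_tr (determinant_alternate i12)// => k.
by rewrite !mxE g12.
Qed.

(* [(1, x)]: its scalar product with [(q0, q)] is [q0 + q . x]. *)
Definition homog m (x : 'rV[R]_m) : 'rV[R]_(1 + m) := row_mx 1%:M x.

Lemma homog0 m (x : 'rV[R]_m) : homog x 0 ord0 = 1.
Proof.
have -> : ord0 = lshift m ord0 :> 'I_(1 + m) by exact: val_inj.
by rewrite row_mxEl mxE eqxx.
Qed.

Definition unip m (x : 'rV[R]_m) : 'M[R]_(1 + m) :=
  \matrix_(k, l) if l == ord0 then homog x 0 k else (k == l)%:R.

Definition dilation m (Q : R) : 'rV[R]_(1 + m) :=
  \row_l if l == ord0 then Q ^+ m else Q^-1.

(* Acting on the right, it sends the row vector [(q0, q)] to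
   [(Q^m (q0 + q . x), q / Q)]. *)
Definition flow m (Q : R) (x : 'rV[R]_m) : 'M[R]_(1 + m) :=
  unip x *m diag_mx (dilation m Q).

Lemma mulmx_unip j m (A : 'M[R]_(j, 1 + m)) (x : 'rV[R]_m) i l :
  (A *m unip x) i l =
    if l == ord0 then \sum_k homog x 0 k * A i k else A i l.
Proof.
rewrite mxE; case: ifP => l0.
  by apply: eq_bigr => k _; rewrite mxE l0 mulrC.
rewrite (bigD1 l)//= big1 ?addr0 => [|k kl]; rewrite mxE l0 ?eqxx ?mulr1//.
by rewrite (negPf kl) mulr0.
Qed.

Lemma det_colsub_flow j m (A : 'M[R]_(j, 1 + m)) Q (x : 'rV[R]_m) g :
  \det (colsub g (A *m flow Q x)) =
    (\prod_i dilation m Q 0 (g i)) * \det (colsub g (A *m unip x)).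
Proof.
have -> : colsub g (A *m flow Q x) =
    colsub g (A *m unip x) *m diag_mx (\row_i dilation m Q 0 (g i)).
  by rewrite mulmxA; apply/matrixP => a b; rewrite mxE !mul_mx_diag !mxE.
rewrite det_mulmx det_diag mulrC; congr (_ * _).
by apply: eq_bigr => i _; rewrite mxE.
Qed.

(** Multilinearity: column [i0] of the minor is the combination of the columns of [A] with weights
    [homog x], and the other columns are those of [A]. *)
Lemma det_colsub_unip j m (A : 'M[R]_(j, 1 + m)) (g : 'I_j -> 'I_(1 + m)) i0 :
  g i0 = ord0 -> (forall i, i != i0 -> g i != ord0) ->
  forall x : 'rV[R]_m, \det (colsub g (A *m unip x)) =
    \sum_l homog x 0 l * \det (colsub (dfwith g i0 l) A).
Proof.
move=> gi0 gi x; rewrite (expand_det_col _ i0).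
under eq_bigr => i _.
  rewrite mxE mulmx_unip gi0 eqxx mulr_suml.
  over.
rewrite exchange_big; apply: eq_bigr => l _ /=.
rewrite (expand_det_col _ i0) mulr_sumr; apply: eq_bigr => i _.
rewrite [colsub (dfwith _ _ _) _ _ _]mxE dfwithin -mulrA; congr (_ * (_ * _)).
rewrite /cofactor; congr (_ * \det _); apply/matrixP => a b.
rewrite mxE [LHS]mxE [LHS]mxE mulmx_unip (negPf (gi _ _)) ?neq_lift//; last first.
  by rewrite eq_sym neq_lift.
by rewrite !mxE dfwithout// neq_lift.
Qed.

Lemma det_colsub_unip_const j m (A : 'M[R]_(j, 1 + m)) g (x : 'rV[R]_m) :
  (forall i, g i != ord0) ->
  \det (colsub g (A *m unip x)) = \det (colsub g A).
Proof.
move=> g0; congr (\det _); apply/matrixP => a b.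
by rewrite mxE mulmx_unip (negPf (g0 _)) [RHS]mxE.
Qed.

(** Only column 0 of [A *m flow Q x] depends on [x], and it does so affinely; a minor using it once
    is affine, one avoiding it is constant, one repeating it vanishes. *)
Lemma det_colsub_flow_affine j m (A : 'M[R]_(j, 1 + m)) Q g :
  exists b : 'rV[R]_(1 + m), forall x : 'rV[R]_m,
    \det (colsub g (A *m flow Q x)) = \sum_l homog x 0 l * b 0 l.
Proof.
suff [b bE] : exists b : 'rV[R]_(1 + m), forall x : 'rV[R]_m,
    \det (colsub g (A *m unip x)) = \sum_l homog x 0 l * b 0 l.
  exists ((\prod_i dilation m Q 0 (g i)) *: b) => x.
  rewrite det_colsub_flow bE mulr_sumr; apply: eq_bigr => l _.
  by rewrite mulrCA; congr (_ * _); rewrite mxE.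
have [[i0 gi0]|g0] := pselect (exists i, g i = ord0); last first.
  exists (\row_l (if l == ord0 then \det (colsub g A) else 0)) => x.
  rewrite det_colsub_unip_const; last first.
    by move=> i; apply/eqP => gi; apply: g0; exists i.
  rewrite big_ord_recl homog0 mul1r big1 ?addr0 ?mxE// => l _.
  by rewrite [X in _ * X]mxE mulr0.
have [[i1 [i01 gi1]]|g1] := pselect (exists i, i != i0 /\ g i = ord0).
  exists 0 => x; rewrite (det_colsub_non_inj _ i01) ?gi0//.
  by rewrite big1// => l _; rewrite [X in _ * X]mxE mulr0.
exists (\row_l \det (colsub (dfwith g i0 l) A)) => x.
rewrite (det_colsub_unip _ gi0).
  by apply: eq_bigr => l _; rewrite [X in _ = _ * X]mxE.
by move=> i ii0; apply/eqP => gi; apply: g1; exists i.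
Qed.

(** One factor is [Q ^+ m]; by injectivity of [g] the others, at most [m] in number, are all
    [Q^-1]. *)
Lemma dilation_prod_ge1 j m (Q : R) (g : 'I_j -> 'I_(1 + m)) i0 :
  1 <= Q -> injective g -> g i0 = ord0 -> 1 <= \prod_i dilation m Q 0 (g i).
Proof.
move=> Q1 g_inj gi0; have Q0 : 0 < Q by exact: lt_le_trans Q1.
have jm : (j <= m.+1)%N by have := leq_card _ g_inj; rewrite !card_ord.
case: j g i0 g_inj gi0 jm => [|j] g i0 g_inj gi0; first by case: i0 gi0.
rewrite ltnS => jm.
rewrite (bigD1 i0)//= mxE gi0 eqxx (eq_bigr (fun=> Q^-1)) => [|i ii0]; last first.
  by rewrite mxE -gi0 (inj_eq g_inj) (negPf ii0).
rewrite prodr_const cardC1 card_ord/= exprVn ler_pdivlMr ?exprn_gt0// mul1r.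
exact: ler_weXn2l.
Qed.

(* A largest minor of [A] is a coefficient of the affine function given by a minor
   of [A *m unip x] involving column 0, and [flow] multiplies the latter by
   [Q^(m - j) >= 1], as [A] has [j.+1] rows. *)
Lemma minor_norm_flow_ge m (S : set 'rV[R]_m) (c : R) : 0 <= c ->
  (forall b : 'rV[R]_(1 + m), exists2 y, S y &
    forall l, c * `|b 0 l| <= `|\sum_l homog y 0 l * b 0 l|) ->
  forall j (A : 'M[R]_(j.+1, 1 + m)) Q, 1 <= Q ->
  exists2 y, S y & c * minor_norm A <= minor_norm (A *m flow Q y).
Proof.
move=> c0 cS j A Q Q1; have [g gA] := minor_normP A.
have [y0 Sy0 _] := cS 0.
have [A0|A_neq0] := eqVneq (minor_norm A) 0.
  by exists y0; rewrite // A0 mulr0 minor_norm_ge0.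
have g_inj : injective g.
  move=> i1 i2 g12; apply/eqP; apply: contraNT A_neq0 => i12.
  by rewrite gA (det_colsub_non_inj _ i12)// normr0.
(* If [g] already uses column 0, take [h = g]; otherwise [h] replaces the column [g ord0] by column
   0, and [l] remembers the replaced column. *)
have [i0 [h [l [h_inj hi0 hA]]]] : exists (i0 : 'I_j.+1) (h : 'I_j.+1 -> 'I_(1 + m)) l,
    [/\ injective h, h i0 = ord0 &
        \det (colsub (dfwith h i0 l) A) = \det (colsub g A)].
  have [[i0 gi0]|g0] := pselect (exists i, g i = ord0).
    exists i0, g, ord0; split=> //; congr (\det _); apply: eq_colsub => i.
    by have [->|ii0] := eqVneq i i0; rewrite ?dfwithin ?dfwithout// eq_sym.
  exists ord0, (dfwith g ord0 ord0), (g ord0); split; last 2 first.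
  - by rewrite dfwithin.
  - congr (\det _); apply: eq_colsub => i.
    have [->|ii0] := eqVneq i ord0; rewrite ?dfwithin ?dfwithout// eq_sym//.
  - move=> i1 i2; have [->|i10] := eqVneq i1 ord0;
      have [->//|i20] := eqVneq i2 ord0; rewrite ?dfwithin ?dfwithout 1?eq_sym//.
    + by move=> g2; case: g0; exists i2.
    + by move=> g1; case: g0; exists i1.
    + exact: g_inj.
pose b := \row_l \det (colsub (dfwith h i0 l) A).
have bE k : b 0 k = \det (colsub (dfwith h i0 k) A) by rewrite mxE.
have [y Sy yP] := cS b.
exists y => //; apply: le_trans (le_minor_norm _ h).
rewrite det_colsub_flow (det_colsub_unip _ hi0); last first.
  by move=> i ii0; rewrite -hi0 (inj_eq h_inj).
rewrite gA -hA normrM -bE; apply: le_trans (yP l) _.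
have -> : \sum_l homog y 0 l * b 0 l =
    \sum_l homog y 0 l * \det (colsub (dfwith h i0 l) A).
  by apply: eq_bigr => k _; rewrite bE.
rewrite ler_peMl ?normr_ge0// ger0_norm; first exact: dilation_prod_ge1 hi0.
exact: le_trans (dilation_prod_ge1 _ _ hi0).
Qed.

End minors.

(** * Lower bounds for affine functions from linear independence *)

Lemma row_free_minor (F : fieldType) j n (A : 'M[F]_(j, n)) :
  row_free A -> exists g : 'I_j -> 'I_n, \det (colsub g A) != 0.
Proof.
move=> A_free; have AT : row_full A^T by rewrite /row_full mxrank_tr.
exists (fullrankfun AT); have := fullrowsub_unit AT.
by rewrite unitmxE unitfE -det_tr trmx_mxsub trmxK.
Qed.

Lemma homog_affineE {R : realType} {T : pmetricType R} m (g : T -> 'rV[R]_m)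
    (b : 'rV[R]_(1 + m)) y :
  \sum_l homog (g y) 0 l * b 0 l = affine_comb g (b 0 ord0) (rsubmx b) y.
Proof.
rewrite big_split_ord/= big_ord1; congr (_ + _).
  by rewrite row_mxEl mxE eqxx mul1r; congr (b _ _); apply: val_inj.
by apply: eq_bigr => j _; rewrite row_mxEr mulrC [in RHS]mxE.
Qed.

(** Independence yields [1 + m] points of [A] whose vectors [homog] form an invertible matrix [M].
    The largest entry of [M *m b^T] then controls every entry of [b], with a constant depending on
    [invmx M] only. *)
Lemma indep_lower_bound {R : realType} {T : pmetricType R} m
    (g : T -> 'rV[R]_m) (A : set T) : indep_with_1_on g A ->
  exists2 c : R, 0 < c & forall b : 'rV[R]_(1 + m), exists2 y, (g @` A) y &
    forall l, c * `|b 0 l| <= `|\sum_l homog y 0 l * b 0 l|.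
Proof.
move=> indep.
suff [M M_free MA] : exists2 M : 'M[R]_(1 + m), row_free M &
    forall i, exists2 y, (g @` A) y & row i M = homog y.
  have M_unit : M \in unitmx by rewrite -row_free_unit.
  pose L : R := \sum_i \sum_j `|invmx M i j| + 1.
  have L0 : 0 < L.
    by rewrite ltr_wpDl ?ltr01// sumr_ge0// => i _; rewrite sumr_ge0.
  exists L^-1; first by rewrite invr_gt0.
  move=> b; pose u := M *m b^T.
  have [i _ iP] := @arg_maxP _ _ _ ord0 predT (fun i => `|u i 0|) isT.
  have [y Ay yE] := MA i; exists y => // l.
  have -> : \sum_k homog y 0 k * b 0 k = u i 0.
    by rewrite -yE mxE; apply: eq_bigr => k _; rewrite !mxE.
  rewrite ler_pdivrMl//.
  have -> : b 0 l = (invmx M *m u) l 0 by rewrite mulKmx// mxE.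
  rewrite mxE (le_trans (ler_norm_sum _ _ _))//.
  apply: (@le_trans _ _ (\sum_j `|invmx M l j| * `|u i 0|)).
    by apply: ler_sum => j _; rewrite normrM ler_wpM2l//; exact: iP.
  rewrite -mulr_suml ler_wpM2r// ler_wpDr//.
  rewrite [leRHS](bigD1 l)//= lerDl sumr_ge0// => i' _; exact: sumr_ge0.
suff : forall k, (k <= 1 + m)%N -> exists2 M : 'M[R]_(k, 1 + m), row_free M &
    forall i, exists2 y, (g @` A) y & row i M = homog y.
  exact.
elim=> [_|k IH km].
  by exists 0; [rewrite /row_free mxrank0|case].
have [M M_free MA] := IH (ltnW km).
(* The rows are found greedily: a nonzero [b] killed by the rows chosen so far is, by independence,
   not killed by [homog (g y)] for some [y] in [A], and this vector is the next row. *)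
have [b b0 Mb] : exists2 b : 'cV[R]_(1 + m), b != 0 & M *m b = 0.
  have : cokermx M != 0.
    by rewrite -mxrank_eq0 mxrank_coker (eqP M_free) subn_eq0 -ltnNge.
  move=> /matrix0Pn[i [j Mij]]; exists (col j (cokermx M)).
    by apply/matrix0Pn; exists i, 0; rewrite mxE.
  by rewrite colE mulmxA mulmx_coker mul0mx.
have /existsNP[y /not_implyP[Ay gyb]] :
    ~ forall y, A y -> affine_comb g (b^T 0 ord0) (rsubmx b^T) y = 0.
  move=> /indep[b00 bS0]; move/negP: b0; apply; apply/eqP/trmx_inj/rowP => l.
  rewrite trmx0 [LHS]mxE [RHS]mxE; have [l' ->|l' ->] := split_ordP l.
    by rewrite -b00 !mxE; congr (b _ _); apply: val_inj; rewrite /= ord1.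
  by have /rowP/(_ l') := bS0; rewrite !mxE.
exists (col_mx (homog (g y)) M) => [|i]; last first.
  have [i' ->|i' ->] := split_ordP (i : 'I_(1 + k)).
    exists (g y); first by exists y.
    by apply: etrans (rowKu _ _ _) _; apply/rowP => l; rewrite mxE ord1.
  have [z Az zE] := MA i'; exists z => //; exact: etrans (rowKd _ _ _) zE.
apply: (@inj_row_free _ (1 + k)) => v; rewrite -[v]hsubmxK mul_row_col => vM0.
have v0 : lsubmx v = 0.
  have := congr1 (mulmx^~ b) vM0; rewrite mulmxDl -mulmxA -[_ *m M *m b]mulmxA Mb.
  rewrite mulmx0 addr0 mul0mx => /matrixP/(_ 0 0); rewrite !mxE big_ord1.
  have -> : (homog (g y) *m b) 0 0 = affine_comb g (b^T 0 ord0) (rsubmx b^T) y.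
    by rewrite -homog_affineE mxE; apply: eq_bigr => l _; rewrite [b^T _ _]mxE.
  move=> /eqP; rewrite mulf_eq0 (negPf (introN eqP gyb)) orbF => /eqP v00.
  by apply/matrixP => i j; rewrite !ord1 v00 mxE.
move: vM0; rewrite v0 mul0mx add0r => vM0.
by rewrite (row_free_inj M_free (etrans vM0 (esym (mul0mx _ _)))) row_mx0.
Qed.

(** * Quantitative nondivergence *)

Lemma metric_ball_open {R : realType} {T : metricType R} (x : T) (r : R) :
  open (ball x r).
Proof.
rewrite openE => y; rewrite ballEmdist /= => xyr; apply/nbhs_ballP.
exists (r - mdist x y); first by rewrite /= subr_gt0.
move=> z; rewrite !ballEmdist/= ltrBrDl; apply: le_lt_trans.
exact: metric_triangle.
Qed.

Lemma borel_open {T : ptopologicalType} (A : set T) :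
  open A -> measurable (A : set (borel T)).
Proof. exact: sub_sigma_algebra. Qed.

(** Turns a sum over a countable subfamily into a series, so that it can be integrated term by
    term. *)
Lemma nneseries_esum_inj {R : realType} {I : choiceType} (G : set I)
    (a : I -> \bar R) (f : I -> nat) (b : nat -> \bar R) :
  {in G &, injective f} -> (forall n, 0 <= b n)%E ->
  (forall n, ~ (f @` G) n -> b n = 0%E) -> (forall i, G i -> b (f i) = a i) ->
  (\sum_(n <oo) b n = \esum_(i in G) a i)%E.
Proof.
move=> f_inj b0 bN ba; rewrite nneseries_esumT//.
rewrite -(eq_esum ba) -(reindex_esum _ _ _ b (inj_bij f_inj)) [RHS]esum_mkcond.
apply: eq_esum => n _; case: ifPn => // /negP; rewrite inE => /bN.
exact.
Qed.

(** * The Besicovitch covering argument *)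

Section covering.
Context {R : realType} {T : pmetricType R}.
Implicit Types (mu : {measure set borel T -> \bar R}) (A V : set T).

(** [E'] is the union of the sets [E y] over the centres of a Besicovitch subfamily. Its measure is
    at most [c] times the sum of the measures of the balls, which lie in [V] and overlap at most [N]
    times. *)
Lemma besicovitch_cover : besicovitch T ->
  exists2 N : R, 0 <= N & forall mu A V (t : T -> R) (E : T -> set T) (c : R),
    metric_bounded A -> open V -> 0 <= c ->
    (forall y, A y -> [/\ 0 < t y, ball y (t y) `<=` V,
       measurable (E y : set (borel T)) &
       (mu (E y) <= c%:E * mu (ball y (t y)))%E]) ->
    exists E' : set (borel T), [/\ measurable E',
      (forall x, A x -> exists2 y, A y & ball y (t y) x /\ (E y x -> E' x)) &
      (mu E' <= (c * N)%:E * mu V)%E].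
Proof.
move=> [N bes]; exists N.
  have [||//|G [_ _ /(_ point) []]] := bes set0 set0.
  - by exists 0 => x y [].
  - by move=> B [].
  move=> _; rewrite -lee_fin; apply: le_trans; apply: esum_ge0 => B _.
  by rewrite lee_fin.
move=> mu A V t E c A_bd oV c0 tE.
have [||G [GF /countable_injP[f f_inj] Gcov]] :=
    bes A [set ball y (t y) | y in A] A_bd.
- by move=> _ [y Ay <-]; exists y, (t y) => //; have [] := tE y Ay.
- by move=> y Ay; exists (t y); [have [] := tE y Ay|exists y].
have /choice[ctr ctrP] :
    forall B, exists y, G B -> A y /\ ball y (t y) = B.
  move=> B; have [/GF[y Ay yB]|nGB] := pselect (G B); first by exists y.
  by exists point.
(* [lvl n] has at most one element; this enumerates [G]. *)
pose lvl n := [set B | G B /\ f B = n].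
have lvl_eq n B B' : lvl n B -> lvl n B' -> B = B'.
  by move=> [GB <-] [GB' /esym/f_inj]; apply; rewrite inE.
pose W n := \bigcup_(B in lvl n) B.
pose E_ n := \bigcup_(B in lvl n) E (ctr B).
have lvlP n : (W n = set0 /\ E_ n = set0) \/ exists B,
    [/\ G B, f B = n, W n = ball (ctr B) (t (ctr B)) & E_ n = E (ctr B)].
  have [[B lB]|lN] := pselect (exists B, lvl n B).
    right; exists B; case: (lB) => GB fB; split=> //.
      rewrite (ctrP B GB).2; apply/seteqP; split=> [x [B' lB' B'x]|x Bx].
        by rewrite (lvl_eq _ _ _ lB lB').
      by exists B.
    apply/seteqP; split=> [x [B' lB' B'x]|x Bx]; last by exists B.
    by rewrite (lvl_eq _ _ _ lB lB').
  by left; split; apply/seteqP; split=> // x [B lB]; case: lN; exists B.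
have mW n : measurable (W n : set (borel T)).
  case: (lvlP n) => [[-> _]|[B [_ _ -> _]]]; first exact: measurable0.
  by apply: borel_open; exact: metric_ball_open.
have mE n : measurable (E_ n : set (borel T)).
  case: (lvlP n) => [[_ ->]|[B [GB _ _ ->]]]; first exact: measurable0.
  by have [] := tE _ (ctrP B GB).1.
have WV n : W n `<=` V.
  case: (lvlP n) => [[-> _]//|[B [GB _ -> _]]].
  by have [] := tE _ (ctrP B GB).1.
have EW n : (mu (E_ n) <= c%:E * mu (W n))%E.
  case: (lvlP n) => [[-> ->]|[B [GB _ -> ->]]]; first by rewrite measure0 mule0.
  by have [] := tE _ (ctrP B GB).1.
exists (\bigcup_n E_ n); split.
- exact: bigcupT_measurable.
- move=> x Ax; have [B GB Bx] : exists2 B, G B & B x.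
    apply: contrapT => nB; have := (Gcov x).1.
    rewrite esum1 => [|B GB].
      by rewrite indicE mem_set// lee_fin ler10.
    by rewrite indicE memNset// => Bx; apply: nB; exists B.
  exists (ctr B); first exact: (ctrP B GB).1.
  rewrite (ctrP B GB).2; split=> // Ex.
  by exists (f B) => //; exists B.
(* Integrate the multiplicity bound over [V]: at each point the series of indicators of the [W n] is
   the sum over [G]. *)
have : (\sum_(n <oo) mu (W n) <= N%:E * mu V)%E.
  have mV : measurable (V : set (borel T)) by exact: borel_open.
  rewrite -integral_cst//.
  rewrite (eq_eseriesr (g := fun n => \int[mu]_(x in V) (\1_(W n) x)%:E)%E); last first.
    by move=> n _; rewrite integral_indic//; congr (mu _); rewrite setIidl.
  have mI n : measurable_fun (V : set (borel T)) (fun x => (\1_(W n) x : R)%:E).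
    by apply/measurable_EFinP; exact: measurable_indic.
  have I0 n x : V x -> (0 <= (\1_(W n) x : R)%:E)%E by rewrite lee_fin.
  rewrite -(integral_nneseries mu mV mI I0).
  apply: ge0_le_integral => //.
  - by move=> x _; apply: nneseries_ge0 => n _ _; rewrite lee_fin.
  - by apply: ge0_emeasurable_sum => // n x _ _; rewrite lee_fin.
  move=> x _; apply: le_trans (Gcov x).2.
  rewrite (nneseries_esum_inj (a := fun B => (\1_B x)%:E) f_inj)//.
  - move=> n nfG; case: (lvlP n) => [[-> _]|[B [GB fB]]]; first by rewrite indic0.
    by case: nfG; exists B.
  - move=> B GB; case: (lvlP (f B)) => [[WB _]|[B' [GB' fB' -> _]]]; last first.
      rewrite (ctrP B' GB').2; have -> // : B' = B.
      by apply: f_inj => //; rewrite inE.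
    have : B `<=` W (f B) by move=> y By; exists B.
    by rewrite WB subset0 => ->; rewrite indic0.
move=> WN; apply: le_trans (generalized_Boole_inequality mu mE _) _.
  exact: bigcupT_measurable.
rewrite EFinM -muleA; apply: le_trans (lee_wpmul2l _ WN); last by rewrite lee_fin.
by rewrite -nneseriesZl//; apply: lee_nneseries.
Qed.

End covering.

Section marked_points.
Context {R : realType} {T I : Type}.
Variables (rel : I -> I -> Prop) (psi : I -> T -> R) (eps rho : R).

(* Chains of pairwise related elements of [P] have length at most [k]. *)
Fixpoint height_le (k : nat) (P : set I) : Prop :=
  if k is k'.+1 then forall s, P s -> height_le k' (P `&` rel s)
  else forall s, ~ P s.

(* There is a chain in [P], of length at most [k], on which [psi _ x] lies in
   [[eps, rho]] and such that [psi s x >= rho] for any [s] in [P] related to all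
   its members; see [marked_flag]. *)
Fixpoint marked (k : nat) (P : set I) (x : T) : Prop :=
  (forall s, P s -> rho <= psi s x) \/
  if k is k'.+1 then
    exists s, [/\ P s, eps <= psi s x, psi s x <= rho & marked k' (P `&` rel s) x]
  else False.

End marked_points.

Lemma ball_subset_ball {R : realType} {T : metricType R} (x y : T) (r t u : R) :
  ball x r y -> r + t <= u -> ball y t `<=` ball x u.
Proof.
rewrite ballEmdist/= => xy rtu z; rewrite !ballEmdist/= => yz.
apply: lt_le_trans rtu; apply: le_lt_trans (metric_triangle _ y _) _.
exact: ltrD.
Qed.

(* Instead of covering by maximal balls on which some [psi s] stays below
   [rho], as Kleinbock and Margulis do, it suffices that tripling the radius
   destroys this property for every [s]; then no local finiteness of the family
   [psi] is needed. *)
Lemma quantitative_nondivergence {R : realType} {T : pmetricType R} (D : R) :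
  besicovitch T -> 0 <= D -> forall k, exists2 kappa : R, 0 <= kappa &
  forall (mu : {measure set borel T -> \bar R}) (U : set T),
  (forall x r, supp mu x -> 0 < r -> ball x (3 * r) `<=` U ->
     (mu (ball x (3 * r)%R) <= D%:E * mu (ball x r))%E) ->
  forall (I : Type) (rel : I -> I -> Prop) (psi : I -> T -> R) (eps rho c : R),
  0 <= c -> (forall s a, open [set x | psi s x < a]) ->
  (forall s x r, supp mu x -> 0 < r -> ball x r `<=` U ->
     (exists z, [/\ ball x r z, supp mu z & rho <= psi s z]) ->
     (mu (ball x r `&` [set y | (psi s y < eps)%R]) <= c%:E * mu (ball x r))%E) ->
  forall (P : set I) x0 r, height_le rel k P -> supp mu x0 -> 0 < r ->
  ball x0 (9 ^+ k * r) `<=` U ->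
  (forall s, P s -> exists z, [/\ ball x0 r z, supp mu z & rho <= psi s z]) ->
  exists E : set (borel T), [/\ measurable E,
    (forall x, ball x0 r x -> supp mu x -> ~ marked rel psi eps rho k P x -> E x) &
    (mu E <= (kappa * c)%:E * mu (ball x0 r))%E].
Proof.
move=> bes D0; have [N N0 cover] := besicovitch_cover bes.
elim=> [|k [kappa kappa0 IH]].
  exists 0 => // mu U _ I rel psi eps rho c _ _ _ P x0 r ht _ _ _ _.
  exists set0; split; [exact: measurable0| |by rewrite measure0 mul0r mul0e].
  by move=> x _ _ []; left => s Ps; have := ht s Ps.
exists ((kappa + 1) * D * N * D); first by rewrite !mulr_ge0// addr_ge0.
move=> mu U fed I rel psi eps rho c c0 psi_open good P x0 r ht x0s r0 bU Prho.
have k9 : 1 <= 9 ^+ k :> R by rewrite exprn_ege1// ler1n.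
(* At a point of the ball and the support outside [A], the first alternative of [marked] holds, so
   only [A] has to be covered. *)
pose A := [set y | [/\ ball x0 r y, supp mu y & exists2 s, P s & psi s y < rho]].
have main y : exists tE : R * set T, A y ->
    [/\ 0 < tE.1, ball y tE.1 `<=` ball x0 (3 * r),
      measurable (tE.2 : set (borel T)),
      (mu tE.2 <= ((kappa + 1) * c * D)%:E * mu (ball y tE.1))%E &
      forall x, ball y tE.1 x -> supp mu x ->
        ~ marked rel psi eps rho k.+1 P x -> tE.2 x].
  have [Ay|] := pselect (A y); last by exists (0, set0).
  case: (Ay) => x0y ys [s0 Ps0 s0y].
  pose S := [set t | 0 < t /\ exists2 s, P s &
    forall z, ball y t z -> supp mu z -> psi s z < rho].
  have S_lt t : S t -> t < 2 * r.
    move=> [t0 [s Ps st]]; rewrite ltNge; apply/negP => rt.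
    have [z [x0z zs]] := Prho _ Ps; rewrite leNgt => /negP; apply; apply: st => //.
    by apply: (ball_subset_ball (ball_sym x0y)) x0z; lra.
  have [t0 St0] : exists t, S t.
    have /nbhs_ballP[t t0 tP] : nbhs y [set x | psi s0 x < rho].
      by move: (psi_open s0 rho); rewrite openE => /(_ y s0y).
    by exists t; split=> //; exists s0 => // z yz _; exact: tP.
  (* Radii in [S] are less than [2 * r], so tripling repeatedly must leave [S]. *)
  have [t [St S3t]] : exists t, S t /\ ~ S (3 * t).
    apply: contrapT => nS.
    have S3 n : S (3 ^+ n * t0).
      elim: n => [|n Sn]; first by rewrite mul1r.
      by apply: contrapT => Sn1; apply: nS; exists (3 ^+ n * t0); rewrite mulrA -exprS.
    have [n] : exists n, 2 * r / t0 < n%:R.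
      exists (Num.bound (2 * r / t0)); apply: archi_boundP.
      by rewrite divr_ge0 ?mulr_ge0 ?ltW//; case: St0.
    have t00 := St0.1; rewrite ltr_pdivrMr// => rn.
    have := lt_trans (S_lt _ (S3 n)) rn; rewrite ltr_pM2r// ltNge => /negP; apply.
    rewrite -natrX ler_nat; exact/ltnW/ltn_expl.
  have [t_gt0 [s Ps st]] := St; have t2r := S_lt _ St.
  (* As [3 * t] is not in [S], every member of [P] reaches [rho] on the tripled ball; there the
     induction hypothesis applies to the members related to [s], and goodness to [s] itself. *)
  have P3 i : P i -> exists z, [/\ ball y (3 * t) z, supp mu z & rho <= psi i z].
    move=> Pi; apply: contrapT => nz; apply: S3t; split; first by rewrite mulr_gt0.
    exists i => // z yz zs; rewrite ltNge; apply/negP => iz.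
    by apply: nz; exists z.
  have t3 : 0 < 3 * t by rewrite mulr_gt0.
  (* This inclusion fixes the factor 9: [y] is within [r] of [x0] and [3 * t < 6 * r], so a radius
     of [7 * 9 ^+ k * r] around [x0] already suffices. *)
  have y3 : ball y (9 ^+ k * (3 * t)) `<=` U.
    apply: subset_trans bU; apply: ball_subset_ball x0y _; rewrite exprS.
    have -> : 9 * 9 ^+ k * r = 9 ^+ k * (9 * r) by rewrite mulrAC mulrC.
    have : 9 ^+ k * (3 * t) <= 9 ^+ k * (6 * r).
      by rewrite ler_wpM2l//; lra.
    have : r <= 9 ^+ k * r by rewrite ler_peMl// ltW.
    have -> : 9 ^+ k * (9 * r) = 9 ^+ k * (6 * r) + 3 * (9 ^+ k * r) by ring.
    lra.
  have y3U : ball y (3 * t) `<=` U.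
    by apply: subset_trans y3; apply: le_ball; rewrite ler_peMl// ltW.
  have [|E1 [mE1 E1P E1mu]] := IH mu U fed I rel psi eps rho c c0 psi_open good
    (P `&` rel s) y (3 * t) (ht s Ps) ys t3 y3.
    by move=> i [Pi _]; exact: P3.
  (* Off [E2] the value of [psi s] is at least [eps], and on the ball of radius [t] it is below
     [rho]; off [E1] a chain for the related members exists, and [s] extends it. *)
  pose E2 := ball y (3 * t) `&` [set x | psi s x < eps].
  have mE2 : measurable (E2 : set (borel T)).
    by apply: borel_open; apply: openI; [exact: metric_ball_open|exact: psi_open].
  have E2mu := good s y (3 * t) ys t3 y3U (P3 s Ps).
  exists (t, E1 `|` E2) => _ /=; split=> //.
  - by apply: ball_subset_ball x0y _; lra.
  - exact: measurableU.
  - apply: (@le_trans _ _ (mu E1 + mu E2)%E); first exact: measureU2.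
    apply: (@le_trans _ _ (((kappa + 1) * c)%:E * mu (ball y (3 * t)))%E).
      rewrite mulrDl mul1r EFinD ge0_muleDl ?lee_fin ?mulr_ge0//.
      exact: leeD.
    rewrite [((kappa + 1) * c * D)%:E]EFinM -muleA; apply: lee_wpmul2l.
      by rewrite lee_fin mulr_ge0// addr_ge0.
    exact: fed.
  - move=> x yx xs nm; have [xe|xe] := ltP (psi s x) eps.
      by right; split=> //; apply: le_ball yx; lra.
    left; apply: E1P => //; first by apply: le_ball yx; lra.
    move=> mx; apply: nm; right; exists s; split=> //.
    exact/ltW/st.
have {main} [tE tEP] := choice main.
have x03 : ball x0 (3 * r) `<=` U.
  apply: subset_trans bU; apply: le_ball.
  have : 9 * r <= 9 ^+ k.+1 * r by rewrite exprS -mulrA ler_pM2l// ler_peMl// ltW.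
  lra.
have [|||y Ay|E [mE Ecov Emu]] := cover mu A (ball x0 (3 * r)) (fun y => (tE y).1)
    (fun y => (tE y).2) ((kappa + 1) * c * D).
- exists (r + r) => y z [x0y _ _] [x0z _ _]; apply: ltW.
  move: x0y x0z; rewrite !ballEmdist/= metric_sym => yx0 x0z.
  by apply: le_lt_trans (metric_triangle _ x0 _) _; exact: ltrD.
- exact: metric_ball_open.
- by rewrite !mulr_ge0// addr_ge0.
- by have [] := tEP y Ay.
exists E; split=> //.
  move=> x x0x xs nm; have Ax : A x.
    split=> //; apply: contrapT => ns; apply: nm; left => s Ps.
    by rewrite leNgt; apply/negP => sx; apply: ns; exists s.
  have [y Ay [yx yE]] := Ecov x Ax; apply: yE.
  by have [_ _ _ _] := tEP y Ay; apply.
(* The last factor [D] compares the ball of radius [3 * r], which contains all the covering balls,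
   with that of radius [r]. *)
apply: le_trans Emu _.
have -> : (kappa + 1) * D * N * D * c = (kappa + 1) * c * D * N * D by ring.
rewrite [X in (_ <= X%:E * _)%E]mulrC [X in (_ <= X * _)%E]EFinM muleC -muleA.
rewrite muleC [X in (_ <= X)%E]muleCA; apply: lee_wpmul2l.
  by rewrite lee_fin !mulr_ge0// addr_ge0.
exact: fed.
Qed.

(** * Lattices of integral points *)

(** [F] collects the members chosen at the successive levels of [marked]. Each is taken from a set
    already cut down to what is related to the earlier ones, so symmetry makes them pairwise
    related. *)
Lemma marked_flag {R : realType} {T I : Type} (rel : I -> I -> Prop)
    (psi : I -> T -> R) eps rho k (P : set I) x :
  (forall s t, rel s t -> rel t s) -> marked rel psi eps rho k P x ->
  exists F : set I, [/\ F `<=` P, (forall s, F s -> eps <= psi s x <= rho),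
    (forall s t, F s -> F t -> s = t \/ rel s t) &
    forall s, P s -> (forall t, F t -> rel t s) -> rho <= psi s x].
Proof.
move=> rel_sym; elim: k P => [|k IH] P.
  case=> // Prho; exists set0; split=> // s Ps _; exact: Prho.
case=> [Prho|[s [Ps es sr /IH[F [FP Fpsi Frel Frho]]]]].
  by exists set0; split=> // s Ps _; exact: Prho.
exists (s |` F); split.
- by move=> t [->//|/FP[]].
- by move=> t [->|/Fpsi//]; rewrite es sr.
- move=> t u [->|Ft] [->|Fu]; [by left| | |exact: Frel].
  + by right; have [] := FP u Fu.
  + by right; apply: rel_sym; have [] := FP t Ft.
- move=> t Pt tF; apply: Frho => [|u Fu]; last by apply: tF; right.
  by split=> //; apply: tF; left.
Qed.

Section integral_matrices.
Context {K : fieldExtType rat}.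

Definition integral_mx j n (A : 'M[K]_(j, n)) := forall i l, in_OK (A i l).

Lemma in_OK1 : in_OK (1 : K).
Proof. exact: (integral1 (intr : {rmorphism int -> K})). Qed.

Lemma in_OKN (x : K) : in_OK x -> in_OK (- x).
Proof. exact: (@integral_opp _ _ (intr : {rmorphism int -> K})). Qed.

Lemma in_OKD (x y : K) : in_OK x -> in_OK y -> in_OK (x + y).
Proof. exact: (@integral_add _ _ (intr : {rmorphism int -> K})). Qed.

Lemma in_OKM (x y : K) : in_OK x -> in_OK y -> in_OK (x * y).
Proof. exact: (@integral_mul _ _ (intr : {rmorphism int -> K})). Qed.

Lemma in_OK_det n (A : 'M[K]_n) : integral_mx A -> in_OK (\det A).
Proof.
move=> A_int; rewrite /determinant; elim/big_ind: _ => [||p _].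
- by rewrite -(subrr 1); apply: in_OKD; [|apply: in_OKN]; exact: in_OK1.
- exact: in_OKD.
apply: in_OKM.
  elim: (nat_of_bool _) => [|k IHk]; first by rewrite expr0; exact: in_OK1.
  by rewrite exprS mulN1r; exact: in_OKN.
by elim/big_ind: _ => [||i _]; [exact: in_OK1|exact: in_OKM|exact: A_int].
Qed.

End integral_matrices.

(** * Minimal lattices, covolumes and flags *)

Section lattices.
Context {R : realType} {K : fieldExtType rat} {d : nat}.
Variable sigma : 'I_d -> {rmorphism K -> R}.
Hypothesis dimK : \dim {:K} = d.
Hypothesis sigma_inj : forall s t, sigma s =1 sigma t -> s = t.

(* A basis of least covolume among the bases of its span with entries in [O_K];
   since [O_K] need not be principal, it may fail to generate the lattice of all
   integral points of the span. *)
Definition minimal_mx j n (A : 'M[K]_(j, n)) : Prop :=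
  [/\ integral_mx A, row_free A & forall C : 'M[K]_j, \det C != 0 ->
    integral_mx (C *m A) -> 1 <= \prod_s `|sigma s (\det C)|].

(** Replacing [A] by [C *m A] multiplies a fixed nonzero minor by [\det C]. While [C *m A] is
    integral, the norm of this minor is a positive integer in absolute value, so a least value is
    attained. *)
Lemma minimal_mx_exists j n (A : 'M[K]_(j, n)) :
  integral_mx A -> row_free A ->
  exists2 C : 'M[K]_j, \det C != 0 & minimal_mx (C *m A).
Proof.
move=> A_int A_free; have [g a0] := row_free_minor A_free.
set a := \det (colsub g A) in a0.
pose good C := \det C != 0 /\ integral_mx (C *m A).
pose nrm (C : 'M[K]_j) := \prod_s `|sigma s (\det C * a)|.
have goodN C : good C -> exists2 N : nat, (0 < N)%N & nrm C = N%:R.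
  move=> [C0 CA]; apply: (prod_embeddings_natE dimK sigma_inj).
    by rewrite -det_mulmx mulmx_colsub; apply: in_OK_det => i l; rewrite mxE; exact: CA.
  by rewrite mulf_neq0.
have exN : exists N, `[< exists2 C, good C & nrm C = N%:R >].
  have [|N _ N1] := goodN 1%:M; first by rewrite /good det1 oner_eq0 mul1mx.
  by exists N; apply/asboolP; exists 1%:M; rewrite // /good det1 oner_eq0 mul1mx.
case: (ex_minnP exN) => N /asboolP[C C_good CN] Nmin.
exists C; first by have [] := C_good.
have [C0 CA] := C_good; split=> //.
  by rewrite /row_free mxrankMfree// -/(row_free C) row_free_unit unitmxE unitfE.
move=> C' C'0 C'CA; have C'C_good : good (C' *m C).
  by rewrite /good det_mulmx mulf_neq0// -mulmxA.
have [N' N'0 C'CN] := goodN _ C'C_good.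
have [N0 N0_gt0 CN0] := goodN _ C_good.
have : nrm C <= nrm (C' *m C).
  rewrite CN C'CN ler_nat; apply: Nmin; apply/asboolP.
  by exists (C' *m C).
have -> : nrm (C' *m C) = (\prod_s `|sigma s (\det C')|) * nrm C.
  rewrite -big_split; apply: eq_bigr => s _ /=.
  by rewrite det_mulmx -mulrA rmorphM normrM.
by rewrite CN0 ler_pMl ?ltr0n.
Qed.

(** Some minor of the integral matrix is nonzero, and its norm is at least 1 in absolute value. *)
Lemma minimal_mx_minor_norm j n (A : 'M[K]_(j, n)) : minimal_mx A ->
  1 <= \prod_s minor_norm (map_mx (sigma s) A).
Proof.
move=> [A_int A_free _]; have [g a0] := row_free_minor A_free.
have aO : in_OK (\det (colsub g A)) by apply: in_OK_det => i l; rewrite mxE; exact: A_int.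
have [N N0 aN] := prod_embeddings_natE dimK sigma_inj aO a0.
apply: (@le_trans _ _ (\prod_s `|sigma s (\det (colsub g A))|)).
  by rewrite aN ler1n.
apply: ler_prod => s _; rewrite normr_ge0 -det_map_mx map_mxsub/=.
exact: le_minor_norm.
Qed.

(** The successor keeps the zero subspace out of the minimal lattices; [marked_short_vector] treats
    it apart, through [Num.max rho 1]. *)
Definition lattice n := {j : nat & 'M[K]_(j.+1, n)}.

Definition minimal_lattices n : set (lattice n) := [set L | minimal_mx (tagged L)].

Definition nested n (L M : lattice n) : Prop :=
  (tagged L < tagged M)%MS \/ (tagged M < tagged L)%MS.

(* The covolume of the image under [H] of the lattice spanned by [L], up to a
   bounded factor. *)
Definition covol n (H : 'I_d -> 'M[R]_n) (L : lattice n) : R :=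
  \prod_s minor_norm (map_mx (sigma s) (tagged L) *m H s).

(** Members of a chain have distinct ranks between 1 and [n]; the induction runs over the list of
    ranks still available. *)
Lemma height_minimal_lattices n : height_le (@nested n) n (@minimal_lattices n).
Proof.
suff : forall (r : seq nat) (P : set (lattice n)), uniq r ->
    (forall L, P L -> \rank (tagged L) \in r) -> height_le (@nested n) (size r) P.
  move=> /(_ (iota 1 n) (@minimal_lattices n) (iota_uniq _ _)); rewrite size_iota.
  apply=> -[j A] [_ A_free _] /=.
  by rewrite mem_iota add1n ltnS rank_leq_col (eqP A_free).
move=> r P; move rk : (size r) => k.
elim: k r P rk => [|k IH] r P rk r_uniq Pr L PL; have Lr := Pr L PL.
  by rewrite (size0nil rk) in Lr.
apply: (IH (rem (\rank (tagged L)) r)); rewrite ?rem_uniq ?size_rem ?rk//.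
move=> M [PM LM]; rewrite mem_rem_uniq// inE Pr// andbT.
by case: LM => /rank_ltmx; rewrite ltn_neqAle => /andP[]//; rewrite eq_sym.
Qed.

(** Bases of the same span differ by an invertible [C], and minimality of the first one bounds the
    norm of [\det C] below by 1. Used both ways, it makes the covolume of a minimal lattice a
    function of the subspace, for every [H]. *)
Lemma covol_le_eqmx n (H : 'I_d -> 'M[R]_n) (L M : lattice n) :
  minimal_lattices L -> minimal_lattices M -> (tagged L == tagged M)%MS ->
  covol H L <= covol H M.
Proof.
case: L M => [j A] [k B] [_ A_free A_min] [B_int B_free _] /= AB.
have kj : k = j.
  have : \rank A = \rank B by rewrite (eqmxP AB).
  by rewrite (eqP A_free) (eqP B_free) => -[->].
move: kj B AB B_int B_free => -> B AB B_int B_free.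
have [C CB] := submxP (andP AB).2.
have C0 : \det C != 0.
  rewrite -unitfE -unitmxE -row_free_unit /row_free.
  by rewrite -(mxrankMfree C A_free) -CB (eqP B_free).
have := A_min C C0; rewrite -CB => /(_ B_int) C1.
rewrite /covol/= CB; under [leRHS]eq_bigr do
  rewrite map_mxM -mulmxA minor_normM det_map_mx.
rewrite big_split/= ler_peMl// prodr_ge0// => s _; exact: minor_norm_ge0.
Qed.

(* Adjoin [v] to the largest member [B] of the flag not containing it: the span
   of [v] and [B] is nested with, or equal to, every member of the flag. *)
Lemma marked_short_vector n (H : 'I_d -> 'M[R]_n) (eps rho : R) T k x
    (psi : lattice n -> T -> R) (v : 'rV[K]_n) (e : 'I_d -> R) :
  (forall L, psi L x = covol H L) ->
  eps <= rho -> marked (@nested n) psi eps rho k (@minimal_lattices n) x ->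
  v != 0 -> integral_mx v -> (forall s, 0 <= e s) ->
  (forall s l, `|(map_mx (sigma s) v *m H s) 0 l| <= e s) ->
  eps <= n%:R ^+ d * Num.max rho 1 * \prod_s e s.
Proof.
move=> psiE eps_rho mx v0 v_int e0 ve.
have nested_sym (L M : lattice n) : nested L M -> nested M L.
  by case=> LM; [right|left].
have {mx} [F [FP Fpsi Fnest Frho]] := marked_flag nested_sym mx.
(* [B] is a member of largest rank among those not containing [v], or the empty matrix if all
   contain [v]; the latter has covolume at most 1, whence the maximum with 1. *)
have [j [B [B_int B_free Bv Brho [Bsub Bsup]]]] : exists j (B : 'M[K]_(j, n)),
    [/\ integral_mx B, row_free B, ~~ (v <= B)%MS,
      \prod_s minor_norm (map_mx (sigma s) B *m H s) <= Num.max rho 1 &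
      (forall L, F L -> ~~ (v <= tagged L)%MS -> (tagged L <= B)%MS) /\
      (forall L, F L -> (v <= tagged L)%MS -> (B <= tagged L)%MS)].
  have [[L0 [FL0 vL0]]|nF] :=
      pselect (exists L, F L /\ ~~ (v <= tagged L)%MS); last first.
    exists 0%N, 0; split.
    - by case.
    - by rewrite /row_free mxrank0.
    - by apply/negP => /submxP[Z]; rewrite mulmx0 => /eqP; rewrite (negPf v0).
    - rewrite le_max; apply/orP; right; apply: prodr_ile1 => s _.
      by rewrite minor_norm_ge0 minor_norm0.
    - split=> L FL vL; first by case: nF; exists L.
      exact: sub0mx.
  pose good r := `[< exists L, [/\ F L, ~~ (v <= tagged L)%MS & \rank (tagged L) = r] >].
  have ex_good : exists r, good r by exists (\rank (tagged L0)); apply/asboolP; exists L0.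
  have le_good r : good r -> (r <= n)%N.
    by move=> /asboolP[L [_ _ <-]]; exact: rank_leq_col.
  case: (ex_maxnP ex_good le_good) => r /asboolP[V [FV vV Vr]] r_max.
  exists (tag V).+1, (tagged V); have [V_int V_free _] := FP V FV; split=> //.
    by rewrite le_max -/(covol H V) -psiE; have /andP[_ ->] := Fpsi V FV.
  split=> L FL vL.
    have [->//|[|VL]] := Fnest L V FL FV; first by move=> /ltmxW.
    have gL : good (\rank (tagged L)) by apply/asboolP; exists L.
    by have := r_max _ gL; rewrite leqNgt -Vr rank_ltmx.
  have [LV|[/ltmxW LV|/ltmxW//]] := Fnest L V FL FV.
    by rewrite LV (negPf vV) in vL.
  by rewrite (submx_trans vL LV) in vV.
pose A0 : 'M[K]_(1 + j, n) := col_mx v B.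
have A0E : (A0 :=: v + B)%MS by apply: eqmx_sym; exact: addsmxE.
have A0_int : integral_mx A0.
  move=> i l; rewrite /A0; case: (split_ordP i) => i' ->.
    by rewrite col_mxEu.
  by rewrite col_mxEd; exact: B_int.
have A0_free : row_free A0.
  apply: inj_row_free => u; rewrite -[u]hsubmxK mul_row_col => uA0.
  have u0 : lsubmx u = 0.
    apply/eqP/negPn/negP => u0; move/negP: Bv; apply.
    have u00 : lsubmx u 0 0 != 0.
      apply: contraNneq u0 => u00; apply/eqP/matrixP => a b.
      by rewrite !ord1 u00 mxE.
    have -> : v = ((lsubmx u 0 0)^-1 *: - rsubmx u) *m B.
      move/eqP: uA0; rewrite [X in X *m v]mx11_scalar mul_scalar_mx addr_eq0.
      by move=> /eqP vE; rewrite -scalemxAl mulNmx -vE scalerA mulVf// scale1r.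
    exact: submxMl.
  move: uA0; rewrite u0 mul0mx add0r => uB.
  by rewrite (row_free_inj B_free (etrans uB (esym (mul0mx _ _)))) row_mx0.
have jn : (1 + j <= n)%N by rewrite -[leqLHS](eqP A0_free) rank_leq_col.
have [C C0 A'_min] := minimal_mx_exists A0_int A0_free.
have C_unit : C \in unitmx by rewrite unitmxE unitfE.
pose L : lattice n := Tagged (fun j => 'M[K]_(j.+1, n)) (C *m A0).
have LE : (tagged L :=: v + B)%MS.
  by apply: eqmx_trans A0E; apply: eqmxMfull; rewrite row_full_unit.
have Lle : covol H L <= n%:R ^+ d * Num.max rho 1 * \prod_s e s.
  (* Minimality of [C *m A0] is applied to [invmx C], which gives back the integral matrix [A0]. *)
  have C1 : \prod_s `|sigma s (\det C)| <= 1.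
    have [_ _ /(_ (invmx C))] := A'_min.
    rewrite det_inv invr_eq0 C0 mulKmx// => /(_ isT A0_int).
    rewrite (eq_bigr (fun s => `|sigma s (\det C)|^-1)); last first.
      by move=> s _; rewrite fmorphV normfV.
    by rewrite prodfV invf_ge1 // prodr_gt0// => s _; rewrite normr_gt0 fmorph_eq0.
  have -> : covol H L = (\prod_s `|sigma s (\det C)|) *
      \prod_s minor_norm (map_mx (sigma s) A0 *m H s).
    rewrite /covol -big_split; apply: eq_bigr => s _ /=.
    by rewrite map_mxM -mulmxA minor_normM det_map_mx.
  have A00 : 0 <= \prod_s minor_norm (map_mx (sigma s) A0 *m H s).
    by apply: prodr_ge0 => s _; exact: minor_norm_ge0.
  apply: le_trans (ler_wpM2r A00 C1) _; rewrite mul1r.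
  apply: (@le_trans _ _ (\prod_s (n%:R * minor_norm (map_mx (sigma s) B *m H s) * e s))).
    apply: ler_prod => s _; rewrite minor_norm_ge0/=.
    have -> : map_mx (sigma s) A0 = col_mx (map_mx (sigma s) v) (map_mx (sigma s) B).
      exact: map_col_mx.
    rewrite mul_col_mx (le_trans (minor_norm_col_mx _ (e0 s) (ve s)))//.
    by rewrite ler_wpM2r// ler_wpM2r ?minor_norm_ge0// ler_nat.
  rewrite !big_split/= prodr_const card_ord.
  by rewrite ler_wpM2r ?prodr_ge0// ler_wpM2l// exprn_ge0.
apply: le_trans Lle.
(* If a member of the flag has the span of [L], its lower bound [eps] passes to [L]. Otherwise [L]
   is strictly nested with every member, and its covolume is at least [rho]. *)
have [[U [FU UL]]|nF] := pselect (exists U, F U /\ (tagged U == tagged L)%MS).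
  have /andP[eU _] := Fpsi U FU; apply: le_trans eU _; rewrite psiE.
  by apply: covol_le_eqmx => //; exact: FP.
apply: (le_trans eps_rho); rewrite -psiE; apply: Frho => // U FU.
have UL : ~ (tagged U == tagged L)%MS by move=> UL; apply: nF; exists U.
have [vU|vU] := boolP (v <= tagged U)%MS.
  have LU : (tagged L <= tagged U)%MS by rewrite LE addsmx_sub vU Bsup.
  right; rewrite ltmxE LU/=; apply/negP => UL'; apply: UL.
  by rewrite UL'.
have UL' : (tagged U <= tagged L)%MS.
  by rewrite LE (submx_trans (Bsub U FU vU))// addsmxSr.
left; rewrite ltmxE UL'/=; apply/negP => LU; move/negP: vU; apply.
by apply: submx_trans LU; rewrite LE addsmxSl.
Qed.

End lattices.

(** * Product measures *)

Lemma prode_gt0 {R : realDomainType} {I : finType} (F : I -> \bar R) :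
  (forall i, 0 < F i)%E -> (0 < \prod_i F i)%E.
Proof. by move=> F0; elim/big_ind: _ => // x y; exact: mule_gt0. Qed.

(** By the convention [0 * +oo = 0]; it makes a cylinder over a null set null even if other factors
    have infinite measure. *)
Lemma prode_eq0 {R : realDomainType} {I : finType} (F : I -> \bar R) i :
  F i = 0%E -> (\prod_i F i = 0)%E.
Proof. by move=> Fi; rewrite (bigD1 i)//= Fi mul0e. Qed.

Section sup_product.
Context {R : realType} {I : finType} (X : I -> pmetricType R).

Lemma sup_prod_ballE (x : sup_prod X) (r : R) : 0 < r ->
  ball x r = [set y : sup_prod X | forall i, ball (x i) r (y i)].
Proof.
move=> r0; apply/seteqP; split=> y.
  rewrite ballEmdist/= => /bigmax_ltP[_ xy] i; rewrite ballEmdist/=; exact: xy.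
move=> xy; rewrite ballEmdist/=; apply/bigmax_ltP; split=> // i _.
by have := xy i; rewrite ballEmdist.
Qed.

Lemma cylinder_open i (U : set (X i)) :
  open U -> open [set x : sup_prod X | U (x i)].
Proof.
rewrite openE => oU; rewrite openE => x Ux.
have /nbhs_ballP[r r0 rU] := oU _ Ux.
apply/nbhs_ballP; exists r => //; rewrite sup_prod_ballE//.
by move=> y /(_ i)/rU.
Qed.

Lemma sup_prod_dfwith_continuous (x : sup_prod X) i :
  continuous (dfwith x i : X i -> sup_prod X).
Proof.
move=> y U /nbhs_ballP[r r0 rU]; apply/nbhs_ballP; exists r => // z yz.
apply: rU; rewrite sup_prod_ballE// => j.
have [<-|ij] := eqVneq i j; first by rewrite !dfwithin.
by rewrite !dfwithout//; exact: ballxx.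
Qed.

Context (mu_ : forall i, {measure set borel (X i) -> \bar R})
  (mu : {measure set borel (sup_prod X) -> \bar R}).
Hypothesis mu_prod : is_product_measure mu_ mu.

Lemma measure_ball (x : sup_prod X) (r : R) : 0 < r ->
  mu (ball x r) = (\prod_i mu_ i (ball (x i) r))%E.
Proof.
move=> r0; rewrite sup_prod_ballE// (mu_prod (A := fun i => ball (x i) r))// => i.
by apply: borel_open; exact: metric_ball_open.
Qed.

Lemma cylinder_dfwithE i (U : set (X i)) : [set x : sup_prod X | U (x i)] =
  [set x : sup_prod X | forall j, dfwith (fun j : I => [set: X j]) i U j (x j)].
Proof.
apply/seteqP; split=> x /=; last by move/(_ i); rewrite dfwithin.
move=> Ux j; have [<-|ij] := eqVneq i j; first by rewrite dfwithin.
by rewrite dfwithout.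
Qed.

Lemma measurable_dfwith i (U : set (X i)) (A : forall j, set (X j)) j :
  measurable (U : set (borel (X i))) ->
  (forall j, measurable (A j : set (borel (X j)))) ->
  measurable (dfwith A i U j : set (borel (X j))).
Proof.
move=> mU mA; have [<-|ij] := eqVneq i j; first by rewrite dfwithin.
by rewrite dfwithout.
Qed.

Lemma measure_cylinder0 i (U : set (X i)) :
  measurable (U : set (borel (X i))) -> mu_ i U = 0%E ->
  mu [set x | U (x i)] = 0%E.
Proof.
move=> mU U0; rewrite cylinder_dfwithE.
rewrite (mu_prod (A := dfwith (fun j => [set: X j]) i U)) => [|j].
  by apply: (prode_eq0 (i := i)); rewrite dfwithin.
by apply: measurable_dfwith => // k; exact: measurableT.
Qed.

Lemma measurable_cylinder i (U : set (X i)) :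
  measurable (U : set (borel (X i))) ->
  measurable ([set x | U (x i)] : set (borel (sup_prod X))).
Proof.
have: measurable_fun [set: borel (sup_prod X)]
    ((fun x => x i) : borel (sup_prod X) -> borel (X i)).
  apply: (@measurability _ _ (borel (sup_prod X)) (borel (X i)) setT
    (fun x : sup_prod X => x i) (@open (X i)) erefl) => _ [V oV <-].
  rewrite setTI.
  by apply: borel_open; exact: cylinder_open.
by move=> /(_ measurableT U) + mU => /(_ mU); rewrite setTI.
Qed.

Lemma supp_sup_prod (x : sup_prod X) :
  supp mu x <-> forall i, supp (mu_ i) (x i).
Proof.
split=> [xs i U [oU Ux]|xs U [oU Ux]].
  have xU : open_nbhs x [set x : sup_prod X | U (x i)].
    by split => //; exact: cylinder_open.
  rewrite lt0e measure_ge0 andbT; apply/eqP => U0.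
  by have := xs _ xU; rewrite measure_cylinder0 ?ltxx//; exact: borel_open.
have /nbhs_ballP[r r0 rU] : nbhs x U by exact: open_nbhs_nbhs.
apply: (@lt_le_trans _ _ (mu (ball x r))).
  rewrite measure_ball//; apply: prode_gt0 => i; apply: xs; split.
    exact: metric_ball_open.
  exact: ballxx.
by apply: le_measure => //; rewrite inE; apply: borel_open => //; exact: metric_ball_open.
Qed.

End sup_product.

(** By continuity, [|f|] exceeds any number below [|f z|] on a neighbourhood of [z], of positive
    measure as [z] is in the support. Hence [norm_on] is at least [|f z|], and the ratio in the
    goodness bound is at most [eta]. *)
Lemma good_on_sublevel {R : realType} {T : pmetricType R} (C alpha : R)
    (nu : {measure set borel T -> \bar R}) (V : set T) (f : T -> R) x r z eta :
  0 <= C -> 0 <= alpha -> good_on C alpha nu V f -> continuous f ->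
  supp nu x -> 0 < r -> ball x r `<=` V -> ball x r z -> supp nu z ->
  0 < `|f z| -> 0 < eta ->
  (nu (ball x r `&` [set y | (`|f y| < `|f z| * eta)%R])
     <= (C * eta `^ alpha)%:E * nu (ball x r))%E.
Proof.
move=> C0 alpha0 [_ fgood] fc xs r0 rV xz zs fz0 eta0.
have e0 : 0 < `|f z| * eta by exact: mulr_gt0.
apply: le_trans (fgood x r xs r0 rV _ e0) _.
have nfc : continuous (fun y => `|f y|).
  by move=> y; apply: cvg_norm; exact: fc.
have norm_ge : (`|f z|%:E <= norm_on nu (ball x r) f)%E.
  apply/lee_addgt0Pr => e e_gt0; rewrite -leeBlDr//; apply: ereal_sup_ubound.
  exists (`|f z| - e) => //=; apply: zs; split; last first.
    by split=> //=; rewrite gtrBl.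
  apply: openI; first exact: metric_ball_open.
  by apply: (@open_comp _ _ (fun y => `|f y|) [set u | `|f z| - e < u]).
apply: lee_wpmul2r; first exact: measure_ge0.
rewrite [X in (_ <= X)%E]EFinM; apply: lee_wpmul2l; first by rewrite lee_fin.
rewrite -poweR_EFin; apply: gt0_ler_poweR => //.
- rewrite in_itv/= leey andbT; apply: mule_ge0; first by rewrite lee_fin ltW.
  by rewrite inve_ge0; apply: le_trans norm_ge; rewrite lee_fin ltW.
- by rewrite in_itv/= leey andbT lee_fin ltW.
apply: (@le_trans _ _ ((`|f z| * eta)%:E * (`|f z|^-1)%:E)%E).
  apply: lee_wpmul2l; first by rewrite lee_fin ltW.
  have -> : (`|f z|^-1)%:E = (`|f z|%:E^-1)%E by rewrite inver gt_eqF.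
  have fz0' : (0 <= `|f z|%:E)%E by rewrite lee_fin.
  by rewrite lee_pV2// inE// (le_trans fz0' norm_ge).
by rewrite -EFinM lee_fin mulrAC mulfV ?mul1r// gt_eqF.
Qed.

Lemma measure_bigsetU_le d {T : measurableType d} {R : realType}
    (mu : {measure set T -> \bar R}) {I : Type} (r : seq I) (A : I -> set T) :
  (forall i, measurable (A i)) ->
  (mu (\big[setU/set0]_(i <- r) A i) <= \sum_(i <- r) mu (A i))%E.
Proof.
move=> mA; elim: r => [|i r IH]; first by rewrite !big_nil measure0.
rewrite !big_cons; apply: le_trans (leeD (lexx _) IH).
by apply: measureU2 => //; exact: bigsetU_measurable.
Qed.

(* If the product is less than [rho * eta ^+ d] at [x], then some factor is less
   at [x] than [eta] times its value at [z]. *)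
Lemma product_sublevel {R : realType} d (X : 'I_d -> pmetricType R)
    (mu_ : forall s, {measure set borel (X s) -> \bar R})
    (mu : {measure set borel (sup_prod X) -> \bar R})
    (V : forall s, set (X s)) (C alpha : 'I_d -> R)
    (phi : forall s, X s -> R) (y : sup_prod X) (r rho eta : R) :
  is_product_measure mu_ mu ->
  (forall s, 0 <= C s) -> (forall s, 0 <= alpha s) ->
  (forall s z, exists F : X s -> R, [/\ good_on (C s) (alpha s) (mu_ s) (V s) F,
     continuous F, `|F z| = phi s z & forall x, `|F x| <= phi s x]) ->
  (forall a, open [set x : sup_prod X | \prod_s phi s (x s) < a]) ->
  supp mu y -> 0 < r -> (forall s, ball (y s) r `<=` V s) -> 0 < rho -> 0 < eta ->
  (exists z, [/\ ball y r z, supp mu z & rho <= \prod_s phi s (z s)]) ->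
  (mu (ball y r `&` [set x | (\prod_s phi s (x s) < rho * eta ^+ d)%R])
    <= (\sum_s C s * eta `^ alpha s)%:E * mu (ball y r))%E.
Proof.
move=> mu_prod C0 alpha0 phiF phi_open ys r0 rV rho0 eta0 [z [yz zs zrho]].
have ys' := (supp_sup_prod mu_prod y).1 ys.
have zs' := (supp_sup_prod mu_prod z).1 zs.
have phi_ge0 s x : 0 <= phi s x.
  by have [F [_ _ _ /(_ x)]] := phiF s x; apply: le_trans.
have phi_gt0 s : 0 < phi s (z s).
  rewrite lt0r phi_ge0 andbT; apply/eqP => sz0.
  by move: zrho; rewrite (bigD1 s)//= sz0 mul0r leNgt rho0.
have /all_sig[F FP] : forall s, {F : X s -> R | [/\
    good_on (C s) (alpha s) (mu_ s) (V s) F, continuous F,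
    `|F (z s)| = phi s (z s) & forall x, `|F x| <= phi s x]}.
  by move=> s; apply: cid; exact: phiF.
pose B s := [set x : X s | `|F s x| < `|F s (z s)| * eta].
have B_open s : open (B s).
  have [_ Fc _ _] := FP s.
  apply: (@open_comp _ _ (fun x => `|F s x|) [set u | u < `|F s (z s)| * eta]).
    by move=> x _; apply: cvg_norm; exact: Fc.
  exact: open_lt.
have mball s : measurable (ball (y s) r : set (borel (X s))).
  by apply: borel_open; exact: metric_ball_open.
have mB s : measurable (B s : set (borel (X s))).
  by apply: borel_open; exact: B_open.
pose E s := ball y r `&` [set x : sup_prod X | B s (x s)].
have mE s : measurable (E s : set (borel (sup_prod X))).
  apply: borel_open; apply: openI; first exact: metric_ball_open.
  exact: cylinder_open.
(* [E s] is a box that differs from the ball only in the factor [s], where goodness applies. *)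
have muE s : (mu (E s) <= (C s * eta `^ alpha s)%:E * mu (ball y r))%E.
  pose A t := ball (y t) r `&` dfwith (fun t => [set: X t]) s (B s) t.
  have -> : E s = [set x : sup_prod X | forall t, A t (x t)].
    rewrite /E sup_prod_ballE//; apply/seteqP; split=> x /=.
      move=> [yx Bx] t; split=> //.
      by have [<-|st] := eqVneq s t; rewrite ?dfwithin ?dfwithout.
    move=> Ax; split=> [t|]; first by have [] := Ax t.
    by have [_] := Ax s; rewrite dfwithin.
  rewrite (mu_prod A) => [|t]; last first.
    apply: measurableI; first exact: mball.
    by apply: measurable_dfwith => [|t']; [exact: mB|exact: measurableT].
  rewrite (measure_ball mu_prod)// (bigD1 s)//= [X in (_ <= _ * X)%E](bigD1 s)//=.
  rewrite muleA; apply: lee_pmul => //.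
  - by apply: prode_ge0 => t _; exact: measure_ge0.
  - have [Fgood Fc Fz _] := FP s.
    rewrite /A dfwithin; apply: (good_on_sublevel _ _ Fgood) => //.
    + by move: yz; rewrite sup_prod_ballE//; apply.
    + by rewrite Fz.
  - by rewrite le_eqVlt; apply/orP; left; apply/eqP; apply: eq_bigr => t ts;
      rewrite /A dfwithout 1?eq_sym// setIT.
apply: (@le_trans _ _ (mu (\big[setU/set0]_s E s))).
  apply: le_measure; rewrite ?inE.
  - by apply: borel_open; apply: openI; [exact: metric_ball_open|exact: phi_open].
  - by apply: bigsetU_measurable => s _.
  move=> x [yx]; rewrite /= => xlt; rewrite -bigcup_seq.
  apply: contrapT => nE; move: xlt; apply/negP; rewrite -leNgt.
  apply: (@le_trans _ _ (\prod_s (phi s (z s) * eta))).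
    by rewrite big_split/= prodr_const card_ord ler_wpM2r// exprn_ge0// ltW.
  apply: ler_prod => s _; rewrite mulr_ge0 ?phi_ge0 ?(ltW eta0)//=.
  rewrite leNgt; apply/negP => xs; apply: nE; exists s => /=.
    by rewrite mem_index_enum.
  split=> //; have [_ _ Fz Fle] := FP s.
  by rewrite /B/= Fz; apply: le_lt_trans xs.
apply: le_trans (measure_bigsetU_le _ _ mE) _.
rewrite -sumEFin ge0_sume_distrl; first exact: lee_sum.
by move=> s _; rewrite lee_fin mulr_ge0// powR_ge0.
Qed.

(** Inner regularity reduces the claim to compact subsets of [A], each covered by finitely many of
    the neighbourhoods [W]. *)
Lemma radon_null {R : realType} {T : pmetricType R}
    (mu : {measure set borel T -> \bar R}) (A : set (borel T)) :
  radon mu -> measurable A ->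
  (forall x, A x -> exists2 W, open_nbhs x W & exists E : set (borel T),
    [/\ measurable E, mu E = 0%E & A `&` W `<=` E]) ->
  mu A = 0%E.
Proof.
move=> [_ reg] mA loc; rewrite reg//; apply/eqP; rewrite eq_le; apply/andP; split.
  apply: ge_ereal_sup => _ [C [C_compact CA] <-].
  have /choice[W WP] : forall x, exists W : set T, A x ->
      open_nbhs x W /\ exists E : set (borel T),
      [/\ measurable E, mu E = 0%E & A `&` W `<=` E].
    move=> x; have [/loc[W xW WE]|nAx] := pselect (A x); first by exists W.
    by exists set0.
  have /choice[E EP] : forall x, exists E : set (borel T), A x ->
      [/\ measurable E, mu E = 0%E & A `&` W x `<=` E].
    move=> x; have [Ax|nAx] := pselect (A x); last by exists set0.
    by have [_ [E EP]] := WP x Ax; exists E.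
  move: (C_compact); rewrite compact_cover => /(_ T C W) [||D DC CD].
  - by move=> x /CA/WP[[]].
  - by move=> x Cx; exists x => //; have [[]] := WP x (CA x Cx).
  have DA x : x \in D -> A x by move=> /DC; rewrite inE => /CA.
  have mE x : measurable (if x \in D then E x else set0).
    case: ifPn => xD; last exact: measurable0.
    by have [] := EP x (DA x xD).
  have mC : measurable (C : set (borel T)).
    rewrite -[C]setCK; apply: measurableC; apply: borel_open.
    by apply: closed_openC; apply: compact_closed => //; exact: metric_hausdorff.
  apply: (@le_trans _ _ (mu (\big[setU/set0]_(x <- D) if x \in D then E x else set0))).
    apply: le_measure; rewrite ?inE//; first by apply: bigsetU_measurable.
    move=> y Cy; have [x /= xD Wxy] := CD y Cy.
    rewrite -bigcup_seq; exists x => //; rewrite xD.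
    by have [_ _] := EP x (DA x xD); apply; split=> //; exact: CA.
  apply: le_trans (measure_bigsetU_le _ _ mE) _.
  rewrite big1_seq// => x /= xD; rewrite xD.
  by have [] := EP x (DA x xD).
apply: ereal_sup_ubound; exists set0; last exact: measure0.
by split; [exact: compact0|].
Qed.

Lemma open_supp_setC {R : realType} {T : pmetricType R}
    (mu : {measure set borel T -> \bar R}) : open (~` supp mu).
Proof.
rewrite openE => x /existsNP[U /not_implyP[[oU Ux] U0]].
apply: (@filterS _ _ _ U); last exact: open_nbhs_nbhs.
by move=> y Uy ys; apply: U0; exact: ys.
Qed.

Lemma measurable_supp {R : realType} {T : pmetricType R}
    (mu : {measure set borel T -> \bar R}) :
  measurable (supp mu : set (borel T)).
Proof.
rewrite -[supp mu]setCK; apply: measurableC; apply: borel_open.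
exact: open_supp_setC.
Qed.

Lemma measure_supp_setC {R : realType} {T : pmetricType R}
    (mu : {measure set borel T -> \bar R}) :
  radon mu -> mu (~` supp mu) = 0%E.
Proof.
move=> mu_radon; apply: radon_null => //.
  by apply: borel_open; exact: open_supp_setC.
move=> x /existsNP[U /not_implyP[[oU Ux] U0]]; exists U => //.
exists U; split; [exact: borel_open| |exact: subIsetr].
by apply/eqP; rewrite eq_le measure_ge0 andbT leNgt; exact/negP.
Qed.

(** * Singular vectors and short vectors *)

Section real_continuity.
Context {R : realType} {T : topologicalType}.

Lemma continuous_sum_mulr m (a : 'I_m -> R) (h : 'I_m -> T -> R) :
  (forall j, continuous (h j)) -> continuous (fun y => \sum_j a j * h j y).
Proof.
move=> hc; elim: (index_enum _) => [|j r IH] y.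
  by under eq_fun do rewrite big_nil; exact: cvg_cst.
under eq_fun do rewrite big_cons; apply: cvgD; last exact: IH.
by apply: cvgM; [exact: cvg_cst|exact: hc].
Qed.

Lemma continuous_normr (h : T -> R) :
  continuous h -> continuous (fun y => `|h y|).
Proof. by move=> hc y; apply: cvg_norm; exact: hc. Qed.

Lemma continuous_addr (b : R) (h : T -> R) :
  continuous h -> continuous (fun y => h y + b).
Proof. by move=> hc y; apply: cvgD; [exact: hc|exact: cvg_cst]. Qed.

Lemma continuous_bigmaxr (J : finType) (h : J -> T -> R) :
  (forall j, continuous (h j)) ->
  continuous (fun y => \big[Num.max/0]_j h j y).
Proof.
move=> hc; elim: (index_enum J) => [|j r IH] y.
  by under eq_fun do rewrite big_nil; exact: cvg_cst.
by under eq_fun do rewrite big_cons; apply: continuous_max; [exact: hc|exact: IH].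
Qed.

Lemma continuous_prodr (J : finType) (h : J -> T -> R) :
  (forall j, continuous (h j)) -> continuous (fun y => \prod_j h j y).
Proof.
move=> hc; elim: (index_enum J) => [|j r IH] y.
  by under eq_fun do rewrite big_nil; exact: cvg_cst.
by under eq_fun do rewrite big_cons; apply: cvgM; [exact: hc|exact: IH].
Qed.

Lemma open_lt_continuous (h : T -> R) (a : R) :
  continuous h -> open [set y | h y < a].
Proof.
by move=> hc; apply: (@open_comp _ _ h [set u | u < a]) => // y _; exact: hc.
Qed.

End real_continuity.

Section matrix_norm.
Context {R : realType} {m n : nat}.
Implicit Types (x : 'M[R]_(m, n)) (a : R).

Lemma mx_norm_ltP x a : 0 < a -> `|x| < a <-> forall i j, `|x i j| < a.
Proof.
move=> a0; have -> : `|x| = _ := mx_normrE x; split=> [/bigmax_ltP[_ xa] i j|xa].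
  exact: (xa (i, j)).
by apply/bigmax_ltP; split=> // -[i j] _; exact: xa.
Qed.

Lemma mx_norm_leP x a : 0 <= a -> `|x| <= a <-> forall i j, `|x i j| <= a.
Proof.
move=> a0; have -> : `|x| = _ := mx_normrE x; split=> [/bigmax_leP[_ xa] i j|xa].
  exact: (xa (i, j)).
by apply/bigmax_leP; split=> // -[i j] _; exact: xa.
Qed.

End matrix_norm.

Section singular_set.
Context {R : realType} {K : fieldExtType rat} {d m : nat}.
Variable sigma : 'I_d -> {rmorphism K -> R}.

Definition approximable (c Q : R) (x : 'M[R]_(d, m)) : Prop :=
  exists (q : 'rV[K]_m) (q0 : K),
    [/\ q != 0, (forall j, in_OK (q 0 j)), in_OK q0,
        `| dotKS (embed sigma q) x + embed sigma q0%:M | < c / Q ^+ m &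
        `| embed sigma q | <= Q].

Lemma open_approximable c Q : 0 < c -> 0 < Q -> open [set x | approximable c Q x].
Proof.
move=> c0 Q0; have cQ : 0 < c / Q ^+ m by rewrite divr_gt0// exprn_gt0.
rewrite openE => x [q [q0 [qn0 qO q0O xq qQ]]].
have : \forall y \near x, forall s,
    `|(dotKS (embed sigma q) y + embed sigma q0%:M) s 0| < c / Q ^+ m.
  apply: (@filter_forall _ _ (fun s y =>
    `|(dotKS (embed sigma q) y + embed sigma q0%:M) s 0| < c / Q ^+ m) (nbhs x) _) => s.
  apply: open_nbhs_nbhs; split; last exact: ((mx_norm_ltP _ cQ).1 xq s 0).
  apply: open_lt_continuous; apply: continuous_normr.
  under eq_fun do rewrite !mxE.
  by apply: continuous_addr; apply: continuous_sum_mulr => j; exact: coord_continuous.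
apply: filterS => y yq; exists q, q0; split=> //.
by apply/(mx_norm_ltP _ cQ) => s j; rewrite ord1.
Qed.

(** Countably many values of [c] and [Q] suffice, which exhibits the singular set as countable
    intersections and unions of open sets. *)
Lemma singularP (x : 'M[R]_(d, m)) : singular sigma x <->
  forall k, exists N, forall n, (N <= n)%N ->
    approximable k.+1%:R^-1 n.+1%:R x.
Proof.
split=> [sing k|app c c0].
  have k0 : 0 < k.+1%:R^-1 :> R by rewrite invr_gt0.
  have [M [_ MP]] := sing _ k0.
  exists (Num.bound `|M|) => n Mn; apply: MP.
  apply: le_lt_trans (ler_norm _) _; apply: lt_le_trans (archi_boundP _) _ => //.
  by rewrite ler_nat; exact: leqW.
(* The factor [2 ^+ m] pays for rounding [Q] down to [n.+1], since [Q < n.+2 <= 2 * n.+1]. *)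
have [k kc] : exists k, k.+1%:R^-1 <= c / 2 ^+ m.
  exists (Num.bound (c / 2 ^+ m)^-1).
  have c2 : 0 < c / 2 ^+ m by rewrite divr_gt0// exprn_gt0.
  rewrite -[leRHS]invrK lef_pV2 ?posrE ?invr_gt0//.
  apply: le_trans (ltW (archi_boundP _)) _; first by rewrite invr_ge0 ltW.
  by rewrite ler_nat.
have [N NP] := app k.
exists N.+2%:R; split=> [|Q NQ]; first exact: num_real.
have Q0 : 0 <= Q by apply: le_trans (ltW NQ).
have [n nQ Qn] : exists2 n, n.+1%:R <= Q & Q < n.+2%:R.
  have := Num.Theory.truncn_itv Q0; set t := Num.truncn Q => /andP[tQ Qt].
  have : (0 < t)%N.
    rewrite -ltnS -(ltr_nat R); apply: le_lt_trans Qt; apply: le_trans (ltW NQ).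
    by rewrite ler_nat.
  by case: t tQ Qt => // t; exists t.
have Nn : (N <= n)%N.
  have := lt_trans NQ Qn; rewrite ltr_nat !ltnS; exact: leqW.
have [q [q0 [qn0 qO q0O xq qQ]]] := NP n Nn.
exists q, q0; split=> //; last exact: le_trans qQ nQ.
apply: lt_le_trans xq _.
have Q_gt0 : 0 < Q by apply: lt_le_trans nQ.
rewrite ler_pdivrMr ?exprn_gt0// mulrAC ler_pdivlMr ?exprn_gt0//.
have Q2 : Q ^+ m <= 2 ^+ m * n.+1%:R ^+ m.
  rewrite -exprMn; apply: lerXn2r; rewrite ?nnegrE ?mulr_ge0// ltW//.
  by apply: lt_le_trans Qn _; rewrite -natrM ler_nat mul2n -addnn; lia.
move: kc; rewrite ler_pdivlMr ?exprn_gt0// => kc.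
apply: le_trans (ler_wpM2l _ Q2) _; first by rewrite invr_ge0.
by rewrite mulrA ler_wpM2r ?exprn_ge0.
Qed.

Lemma measurable_preimage_Sing {T : pmetricType R} (f : T -> 'M[R]_(d, m)) :
  continuous f -> measurable (f @^-1` Sing sigma : set (borel T)).
Proof.
move=> fc; have -> : f @^-1` Sing sigma =
    \bigcap_k \bigcup_N \bigcap_(n in [set n | (N <= n)%N])
    f @^-1` [set x | approximable k.+1%:R^-1 n.+1%:R x].
  apply/seteqP; split=> x.
    by move=> /singularP sx k _; have [N NP] := sx k; exists N.
  by move=> sx; apply/singularP => k; have [N _ NP] := sx k I; exists N.
apply: bigcapT_measurable => k; apply: bigcupT_measurable => N.
apply: bigcap_measurable => [|n _]; first by exists N => /=.
apply: borel_open; apply: open_comp => [x _|]; first exact: fc.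
by apply: open_approximable; rewrite ?invr_gt0.
Qed.

(** Dani correspondence with matched scales: [Q ^+ m * (delta ^+ m.+1 / (delta * Q) ^+ m)] and
    [delta * Q / Q] both equal [delta]. *)
Lemma approximable_short_vector (delta Q : R) (x : 'M[R]_(d, m)) :
  0 < delta -> 0 < Q -> approximable (delta ^+ m.+1) (delta * Q) x ->
  exists v : 'rV[K]_(1 + m), [/\ v != 0, integral_mx v &
    forall s l, `|(map_mx (sigma s) v *m flow Q (row s x)) 0 l| <= delta].
Proof.
move=> delta0 Q0 [q [q0 [qn0 qO q0O xq qQ]]].
have dQ : 0 < delta * Q by exact: mulr_gt0.
have cQ : 0 < delta ^+ m.+1 / (delta * Q) ^+ m.
  by rewrite divr_gt0// exprn_gt0.
exists (row_mx q0%:M q); split.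
- by apply: contraNneq qn0 => /(congr1 rsubmx); rewrite row_mxKr => ->; rewrite linear0.
- move=> i l; rewrite ord1; case: (split_ordP l) => l' ->.
    by rewrite row_mxEl ord1 mxE eqxx mulr1n.
  by rewrite row_mxEr.
move=> s l; rewrite mulmxA mul_mx_diag mxE mulmx_unip [dilation m Q 0 l]mxE.
case: ifPn => [_|l0].
  have -> : \sum_k homog (row s x) 0 k * map_mx (sigma s) (row_mx q0%:M q) 0 k =
      (dotKS (embed sigma q) x + embed sigma q0%:M) s 0.
    rewrite big_split_ord/= big_ord1 [RHS]mxE addrC; congr (_ + _).
      rewrite [RHS]mxE; apply: eq_bigr => j _.
      by rewrite row_mxEr mxE [map_mx _ _ _ _]mxE row_mxEr [embed _ _ _ _]mxE mulrC.
    rewrite row_mxEl mxE eqxx mul1r [LHS]mxE row_mxEl.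
    by rewrite [embed _ _ _ _]mxE.
  rewrite normrM (ger0_norm (exprn_ge0 m (ltW Q0))) -ler_pdivlMr ?exprn_gt0//.
  apply: le_trans (ltW ((mx_norm_ltP _ cQ).1 xq s 0)) _.
  rewrite exprMn exprS invfM mulrA mulfK// gt_eqF// exprn_gt0//.
move: l0; case: (split_ordP l) => l' -> l0.
  by case/eqP: l0; apply: val_inj; rewrite /= ord1.
rewrite [map_mx _ _ _ _]mxE row_mxEr normrM normfV (gtr0_norm Q0) ler_pdivrMr//.
by have := (mx_norm_leP _ (ltW dQ)).1 qQ s l'; rewrite mxE.
Qed.

End singular_set.

(** * Singular vectors on the support *)

Lemma sup_prod_proj_continuous {R : realType} {I : finType}
    (X : I -> pmetricType R) i : continuous (fun x : sup_prod X => x i).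
Proof.
move=> x U /nbhs_ballP[r r0 rU]; apply/nbhs_ballP; exists r => // y.
by rewrite sup_prod_ballE// => xy; exact/rU/xy.
Qed.

(** The bound on the quotient can be multiplied out, as the denominator is positive on the support
    and finite inside [W]. *)
Lemma federer_on_tripling {R : realType} {T : pmetricType R} (D : R)
    (mu : {measure set borel T -> \bar R}) (U W : set T) x r :
  federer_on D mu U -> open W -> W `<=` U -> (mu W < +oo)%E ->
  supp mu x -> 0 < r -> ball x (3 * r) `<=` W ->
  (mu (ball x (3 * r)%R) <= D%:E * mu (ball x r))%E.
Proof.
move=> [_ _ supD] oW WU muW xs r0 xW.
have mball t : measurable (ball x t : set (borel T)).
  by apply: borel_open; exact: metric_ball_open.
have b0 : (0 < mu (ball x r))%E.
  by apply: xs; split; [exact: metric_ball_open|exact: ballxx].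
have b_fin : (mu (ball x r) < +oo)%E.
  apply: le_lt_trans muW; apply: le_measure; rewrite ?inE//; first exact: borel_open.
  by apply: subset_trans xW; apply: le_ball; rewrite ler_peMl ?ler1n// ltW.
have : (mu (ball x (3 * r)) / mu (ball x r) < D%:E)%E.
  apply: le_lt_trans supD; apply: ereal_sup_ubound; exists (x, r) => //=.
  by split=> //; exact: subset_trans WU.
have bE : mu (ball x r) = (fine (mu (ball x r)))%:E by rewrite fineK// ge0_fin_numE.
rewrite bE in b0 *; rewrite lte_fin in b0; rewrite inver gt_eqF//.
by move=> /ltW; rewrite lee_pdivrMr.
Qed.

(** The tail intersections [G N] increase to [F], and each has measure at most [b]; continuity from
    below concludes. *)
Lemma eventually_measure_le {d} {T : measurableType d} {R : realType}
    (mu : {measure set T -> \bar R}) (E : nat -> set T) (b : \bar R) :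
  (forall n, measurable (E n)) -> (forall n, mu (E n) <= b)%E ->
  let F := \bigcup_N \bigcap_(n in [set n | (N <= n)%N]) E n in
  measurable F /\ (mu F <= b)%E.
Proof.
move=> mE Eb F; pose G N := \bigcap_(n in [set n | (N <= n)%N]) E n.
have mG N : measurable (G N) by apply: bigcap_measurable => // ; exists N => /=.
have mF : measurable F by exact: bigcupT_measurable.
split=> //.
have ndG : nondecreasing_seq G.
  move=> n k nk; apply/subsetPset => x Gx i /= ki; apply: Gx => /=.
  exact: leq_trans nk ki.
have GF := nondecreasing_cvg_mu (mu := mu) mG mF ndG.
rewrite -(cvg_lim _ GF)//; apply: lime_le; first by apply/cvg_ex; exists (mu F).
apply: nearW => n; apply: le_trans (Eb n); apply: le_measure; rewrite ?inE//.
by move=> x; apply => /=.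
Qed.

Lemma sum_powR_small {R : realType} d (C alpha : 'I_d -> R) (e : R) :
  (forall s, 0 < alpha s) -> 0 < e ->
  exists2 eta : R, 0 < eta <= 1 & \sum_s C s * eta `^ alpha s < e.
Proof.
move=> alpha0 e0.
have lim0 : (\sum_s C s * eta `^ alpha s) @[eta --> 0^'+] --> (0 : R).
  elim: (index_enum _) => [|s r IH].
    by under eq_fun do rewrite big_nil; exact: cvg_cst.
  under eq_fun do rewrite big_cons.
  have := cvgD (cvgM (cvg_cst (C s)) (powR_cvg0 (alpha0 s))) IH.
  by rewrite mulr0 addr0; apply.
have near_e : \forall eta \near 0^'+, \sum_s C s * eta `^ alpha s < e.
  by apply: (cvgr_lt (0 : R)) lim0 _ e0.
have near_1 : \forall eta \near (0 : R)^'+, 0 < eta <= 1.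
  near=> eta; apply/andP; split; first by near: eta; exact: nbhs_right_gt.
  by near: eta; apply: nbhs_right_le.
have [eta [? ?]] := filter_ex (filterI near_1 near_e).
by exists eta.
Unshelve. all: by end_near. Qed.

Section singular_on_support.
Context {R : realType} {K : fieldExtType rat} {d : nat}.
Variable sigma : 'I_d -> {rmorphism K -> R}.
Hypothesis dimK : \dim {:K} = d.
Hypothesis sigma_inj : forall s t, sigma s =1 sigma t -> s = t.
Context {m : nat} (X : 'I_d -> pmetricType R)
  (mu_ : forall s, {measure set borel (X s) -> \bar R})
  (mu : {measure set borel (sup_prod X) -> \bar R})
  (f_ : forall s, X s -> 'rV[R]_m) (f : sup_prod X -> 'M[R]_(d, m)).
Arguments f_ : clear implicits.
Hypothesis bes : besicovitch (sup_prod X).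
Hypothesis mu_prod : is_product_measure mu_ mu.
Hypothesis f_row : forall x s, row s (f x) = f_ s (x s).
Hypothesis f_cont : continuous f.

Definition flow_covol (Q : R) (L : lattice (1 + m)) (x : sup_prod X) : R :=
  covol sigma (fun s => flow Q (f_ s (x s))) L.

(** [f_ s] is read off from [f] on the slice through [point] in direction [s]. *)
Lemma component_continuous s j : continuous (fun y : X s => f_ s y 0 j).
Proof.
have -> : (fun y : X s => f_ s y 0 j) =
    (fun y => f (dfwith (point : sup_prod X) s y : sup_prod X) s j).
  apply/funext => y; have := f_row (dfwith (point : sup_prod X) s y) s.
  by rewrite dfwithin => <-; rewrite mxE.
pose p : X s -> sup_prod X := dfwith (point : sup_prod X) s.
have pc : continuous p by exact: sup_prod_dfwith_continuous.
have gc : continuous (fun M : 'M[R]_(d, m) => M s j) by exact: coord_continuous.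
move=> y; have fpc := continuous_comp (pc y) (@f_cont (p y)).
exact: (continuous_comp fpc (gc (f (p y)))).
Qed.

Lemma affine_comb_continuous s a0 a : continuous (affine_comb (f_ s) a0 a).
Proof.
rewrite /affine_comb; under eq_fun do rewrite addrC.
apply: continuous_addr; apply: continuous_sum_mulr => j.
exact: component_continuous.
Qed.

Lemma flow_minor_affine s j (A : 'M[R]_(j, 1 + m)) (Q : R) (g : 'I_j -> 'I_(1 + m)) :
  exists a0 a, forall y,
    \det (colsub g (A *m flow Q (f_ s y))) = affine_comb (f_ s) a0 a y.
Proof.
have [b bE] := det_colsub_flow_affine A Q g.
by exists (b 0 ord0), (rsubmx b) => y; rewrite bE homog_affineE.
Qed.

Lemma flow_minor_norm_continuous s j (A : 'M[R]_(j, 1 + m)) (Q : R) :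
  continuous (fun y => minor_norm (A *m flow Q (f_ s y))).
Proof.
apply: continuous_bigmaxr => g; apply: continuous_normr.
have [a0 [a aE]] := flow_minor_affine s A Q g.
by under eq_fun do rewrite aE; exact: affine_comb_continuous.
Qed.

Lemma open_flow_covol Q L a : open [set x | flow_covol Q L x < a].
Proof.
apply: open_lt_continuous; rewrite /flow_covol /covol.
apply: continuous_prodr => s x.
apply: (@continuous_comp _ _ _ (fun x : sup_prod X => x s) (fun y : X s =>
  minor_norm (map_mx (sigma s) (tagged L) *m flow Q (f_ s y)))).
  exact: sup_prod_proj_continuous.
exact: flow_minor_norm_continuous.
Qed.

Lemma flow_covol_sublevel (V : forall s, set (X s)) (C alpha : 'I_d -> R)
    Q L (y : sup_prod X) (r rho eta : R) :
  (forall s, 0 <= C s) -> (forall s, 0 <= alpha s) ->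
  (forall s a0 a, good_on (C s) (alpha s) (mu_ s) (V s) (affine_comb (f_ s) a0 a)) ->
  supp mu y -> 0 < r -> (forall s, ball (y s) r `<=` V s) -> 0 < rho -> 0 < eta ->
  (exists z, [/\ ball y r z, supp mu z & rho <= flow_covol Q L z]) ->
  (mu (ball y r `&` [set x | (flow_covol Q L x < rho * eta ^+ d)%R])
    <= (\sum_s C s * eta `^ alpha s)%:E * mu (ball y r))%E.
Proof.
move=> C0 alpha0 good ys r0 rV rho0 eta0 yz.
apply: (@product_sublevel R d X mu_ mu V C alpha (fun s y =>
    minor_norm (map_mx (sigma s) (tagged L) *m flow Q (f_ s y)))) => //.
- move=> s z.
  (* The affine function is the minor attaining [minor_norm] at [z]; at other points its absolute
     value is a lower bound. *)
  have [g gE] := minor_normP (map_mx (sigma s) (tagged L) *m flow Q (f_ s z)).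
  have [a0 [a aE]] := flow_minor_affine s (map_mx (sigma s) (tagged L)) Q g.
  exists (affine_comb (f_ s) a0 a); split.
  + exact: good.
  + exact: affine_comb_continuous.
  + by rewrite -aE gE.
  + by move=> x; rewrite -aE; exact: le_minor_norm.
- by move=> a; exact: open_flow_covol.
Qed.

(** The coordinates of [z] are chosen separately in each factor, losing the constants [c s]; the
    remaining product of minor norms of an integral matrix is at least 1, so [rho] is the product of
    the [c s]. *)
Lemma flow_covol_ge (x0 : sup_prod X) (r : R) : 0 < r -> nonplanar_at mu_ f_ x0 ->
  exists2 rho : R, 0 < rho & forall Q L, 1 <= Q -> minimal_mx sigma (tagged L) ->
    exists z, [/\ ball x0 r z, supp mu z & rho <= flow_covol Q L z].
Proof.
move=> r0 np.
have indep s : indep_with_1_on (f_ s) (ball (x0 s) r `&` supp (mu_ s)).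
  apply: (np (fun s => ball (x0 s) r)); rewrite -sup_prod_ballE//.
  exact: nbhsx_ballx.
have /choice[c cP] : forall s, exists c : R, 0 < c /\
    forall b : 'rV[R]_(1 + m), exists2 y, (f_ s @` (ball (x0 s) r `&` supp (mu_ s))) y &
      forall l, c * `|b 0 l| <= `|\sum_l homog y 0 l * b 0 l|.
  by move=> s; have [c c0 cP] := indep_lower_bound (indep s); exists c.
exists (\prod_s c s); first by apply: prodr_gt0 => s _; have [] := cP s.
move=> Q L Q1 L_min.
have /all_sig[z zP] : forall s, {y : X s | [/\ ball (x0 s) r y, supp (mu_ s) y &
    c s * minor_norm (map_mx (sigma s) (tagged L)) <=
    minor_norm (map_mx (sigma s) (tagged L) *m flow Q (f_ s y))]}.
  move=> s; apply: cid; have [c0 cS] := cP s.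
  have [_ [y [yb ys] <-] yge] :=
    minor_norm_flow_ge (ltW c0) cS (map_mx (sigma s) (tagged L)) Q1.
  by exists y.
exists z; split.
- by rewrite sup_prod_ballE// => s; have [] := zP s.
- by apply/(supp_sup_prod mu_prod) => s; have [] := zP s.
apply: (@le_trans _ _ (\prod_s (c s * minor_norm (map_mx (sigma s) (tagged L))))).
  rewrite big_split/= ler_peMr ?(minimal_mx_minor_norm dimK sigma_inj L_min)//.
  by apply: prodr_ge0 => s _; have [/ltW] := cP s.
apply: ler_prod => s _; have [_ _ ->] := zP s; rewrite andbT.
by rewrite mulr_ge0 ?minor_norm_ge0//; have [/ltW] := cP s.
Qed.

Lemma local_nondivergence (x0 : sup_prod X) : supp mu x0 ->
  (exists2 W, open_nbhs x0 W & (mu W < +oo)%E) ->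
  (exists U, exists2 D : R, 0 < D & open_nbhs x0 U /\ federer_on D mu U) ->
  nonplanar_at mu_ f_ x0 -> (forall s, good_at (f_ s) (mu_ s) (x0 s)) ->
  exists (r rho kappa : R) (C alpha : 'I_d -> R),
    [/\ 0 < r /\ 0 < rho, 0 <= kappa, (forall s, 0 < alpha s),
      (mu (ball x0 r) < +oo)%E &
    forall Q eta, 1 <= Q -> 0 < eta -> exists E : set (borel (sup_prod X)),
      [/\ measurable E,
        (forall x, ball x0 r x -> supp mu x ->
          ~ marked (@nested K (1 + m)) (flow_covol Q) (rho * eta ^+ d) rho (1 + m)
              (@minimal_lattices R K d sigma (1 + m)) x -> E x) &
        (mu E <= (kappa * \sum_s C s * eta `^ alpha s)%:E * mu (ball x0 r))%E]].
Proof.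
move=> x0s [W [oW Wx0] muW] [U [D D0 [[oU Ux0] fedU]]] np good.
have /all_sig[V VP] : forall s, {V : set (X s) | open_nbhs (x0 s) V /\
    exists C alpha : R, [/\ 0 < C, 0 < alpha &
    forall a0 a, good_on C alpha (mu_ s) V (affine_comb (f_ s) a0 a)]}.
  by move=> s; apply: cid; have [V ? ?] := good s; exists V.
have /choice[C CP] : forall s, exists C : R, exists alpha : R, [/\ 0 < C, 0 < alpha &
    forall a0 a, good_on C alpha (mu_ s) (V s) (affine_comb (f_ s) a0 a)].
  by move=> s; have [_] := VP s.
have /choice[alpha alphaP] := CP.
have [r0 r0_gt0 r0W] : exists2 r0 : R, 0 < r0 & ball x0 r0 `<=`
    (U `&` W) `&` [set x : sup_prod X | forall s, V s (x s)].
  have /nbhs_ballP[r0 ? ?] : nbhs x0 ((U `&` W) `&`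
      [set x : sup_prod X | forall s, V s (x s)]).
    apply: filterI; first by apply: filterI; exact: open_nbhs_nbhs.
    apply: (@filter_forall _ _ (fun s (x : sup_prod X) => V s (x s)) (nbhs x0) _) => s.
    have [[oV Vx0] _] := VP s; apply: open_nbhs_nbhs; split=> //.
    exact: cylinder_open.
  by exists r0.
have mW0 : (mu (ball x0 r0) < +oo)%E.
  apply: le_lt_trans muW; apply: le_measure; rewrite ?inE.
  - by apply: borel_open; exact: metric_ball_open.
  - exact: borel_open.
  - by move=> x /r0W[[]].
have [kappa kappa0 nondiv] := quantitative_nondivergence bes (ltW D0) (1 + m).
(* The enlarged ball in the nondivergence estimate is then the ball of radius [r0], where the
   measure is finite and the Federer and goodness bounds hold. *)
pose r := r0 / 9 ^+ (1 + m).
have n9 : 1 <= 9 ^+ (1 + m) :> R by rewrite exprn_ege1// ler1n.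
have n9_gt0 : 0 < 9 ^+ (1 + m) :> R by exact: lt_le_trans n9.
have r_gt0 : 0 < r by rewrite divr_gt0.
have rr0 : 9 ^+ (1 + m) * r = r0 by rewrite mulrC divfK// gt_eqF.
have [rho rho0 rhoP] := flow_covol_ge r_gt0 np.
exists r, rho, kappa, C, alpha; split=> //.
- by move=> s; have [] := alphaP s.
- apply: le_lt_trans mW0; apply: le_measure; rewrite ?inE.
  + by apply: borel_open; exact: metric_ball_open.
  + by apply: borel_open; exact: metric_ball_open.
  + by apply: le_ball; rewrite -rr0 ler_peMl// ltW.
move=> Q eta Q1 eta0.
apply: (nondiv mu (ball x0 r0)) => //.
- move=> x t xs t0 xt; apply: (federer_on_tripling fedU _ _ _ xs t0 xt) => //.
  + exact: metric_ball_open.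
  + by move=> y /r0W[[]].
- apply: sumr_ge0 => s _; rewrite mulr_ge0 ?powR_ge0//.
  by have [/ltW] := alphaP s.
- by move=> L a; exact: open_flow_covol.
- move=> L x t xs t0 xt zP; apply: (@flow_covol_sublevel V) => //.
  + by move=> s; have [/ltW] := alphaP s.
  + by move=> s; have [_ /ltW] := alphaP s.
  + by move=> s; have [] := alphaP s.
  + move=> s z xz; have : (ball x t) (dfwith x s z).
      rewrite sup_prod_ballE// => u; have [<-|su] := eqVneq s u.
        by rewrite dfwithin.
      by rewrite dfwithout//; exact: ballxx.
    by move=> /xt/r0W[_ /(_ s)]; rewrite dfwithin.
- exact: height_minimal_lattices.
- by rewrite rr0.
- by move=> L L_min; exact: rhoP.
Qed.

Lemma local_singular_null (x0 : sup_prod X) : supp mu x0 ->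
  (exists2 W, open_nbhs x0 W & (mu W < +oo)%E) ->
  (exists U, exists2 D : R, 0 < D & open_nbhs x0 U /\ federer_on D mu U) ->
  nonplanar_at mu_ f_ x0 -> (forall s, good_at (f_ s) (mu_ s) (x0 s)) ->
  exists2 W, open_nbhs x0 W & exists E : set (borel (sup_prod X)),
    [/\ measurable E, mu E = 0%E &
        (f @^-1` Sing sigma) `&` supp mu `&` W `<=` E].
Proof.
move=> x0s fin fed np good.
have [r [rho [kappa [C [alpha [[r0 rho0] kappa0 alpha0 muB nondiv]]]]]] :=
  local_nondivergence x0s fin fed np good.
have d0 : (0 < d)%N by rewrite -dimK adim_gt0.
exists (ball x0 r); first by split; [exact: metric_ball_open|exact: ballxx].
have small k : exists F : set (borel (sup_prod X)), [/\ measurable F,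
    (f @^-1` Sing sigma) `&` supp mu `&` ball x0 r `<=` F &
    (mu F <= k.+1%:R^-1%:E * mu (ball x0 r))%E].
  (* The added 1 covers the case [kappa = 0]. *)
  have e0 : 0 < k.+1%:R^-1 / (kappa + 1) :> R.
    by rewrite divr_gt0 ?invr_gt0// ltr_wpDl.
  have [eta /andP[eta0 eta1] eta_lt] := sum_powR_small C alpha0 e0.
  have /choice[E_ E_P] : forall n : nat, exists E : set (borel (sup_prod X)),
      [/\ measurable E,
        (forall x, ball x0 r x -> supp mu x ->
          ~ marked (@nested K (1 + m)) (flow_covol n.+1%:R) (rho * eta ^+ d) rho
              (1 + m) (@minimal_lattices R K d sigma (1 + m)) x -> E x) &
        (mu E <= (kappa * \sum_s C s * eta `^ alpha s)%:E * mu (ball x0 r))%E].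
    by move=> n; apply: nondiv; rewrite ?ler1n.
  have mE n : measurable (E_ n) by have [] := E_P n.
  have muE n : (mu (E_ n) <= k.+1%:R^-1%:E * mu (ball x0 r))%E.
    have [_ _ /le_trans] := E_P n; apply.
    apply: lee_wpmul2r; first exact: measure_ge0.
    rewrite lee_fin (le_trans (ler_wpM2l kappa0 (ltW eta_lt)))//.
    rewrite mulrCA ler_piMr ?invr_ge0// ler_pdivrMr ?mul1r ?lerDl//.
    exact: ltr_wpDl.
  have [mF muF] := eventually_measure_le mE muE.
  exists (\bigcup_N \bigcap_(n in [set n | (N <= n)%N]) E_ n); split=> //.
  move=> x [[xS xs] xB].
  pose B : R := (1 + m)%:R ^+ d * Num.max rho 1.
  have B0 : 0 < B by rewrite mulr_gt0 ?exprn_gt0// lt_max ltr01 orbT.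
  have re0 : 0 < rho * eta ^+ d by rewrite mulr_gt0 ?exprn_gt0.
  (* The minimum with 1 and [0 < d] give [delta ^+ d <= delta]; the factor 2 makes [B * delta ^+ d]
     strictly less than [rho * eta ^+ d], against [marked_short_vector] at a marked point. *)
  pose delta := Num.min 1 (rho * eta ^+ d / (2 * B)).
  have delta0 : 0 < delta by rewrite lt_min ltr01 divr_gt0// mulr_gt0.
  have delta_lt : B * delta ^+ d < rho * eta ^+ d.
    apply: (@le_lt_trans _ _ (B * delta)).
      rewrite ler_pM2l//; apply: ler_iXnr => //; first exact: ltW.
      by rewrite ge_min lexx.
    apply: (@le_lt_trans _ _ (B * (rho * eta ^+ d / (2 * B)))).
      by rewrite ler_pM2l// ge_min lexx orbT.
    rewrite invfM mulrCA [B * _]mulrCA mulfV ?gt_eqF// mulr1.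
    by rewrite ltr_pdivrMr// ltr_pMr// ltr1n.
  have [M [_ MP]] := xS (delta ^+ m.+1) (exprn_gt0 _ delta0).
  exists (Num.bound (`|M| / delta)) => // n Nn.
  have [_ + _] := E_P n; apply=> // mx.
  have MQ : M < delta * n.+1%:R.
    rewrite mulrC -ltr_pdivrMr//; apply: (@le_lt_trans _ _ (`|M| / delta)).
      by rewrite ler_pM2r ?invr_gt0// ler_norm.
    apply: lt_le_trans (archi_boundP _) _; first by rewrite divr_ge0// ltW.
    by rewrite ler_nat; exact: leqW.
  have n0 : 0 < n.+1%:R :> R by [].
  have [v [v0 v_int vle]] := approximable_short_vector delta0 n0 (MP _ MQ).
  have eps_rho : rho * eta ^+ d <= rho.
    by rewrite ler_piMr ?(ltW rho0)// exprn_ile1// ltW.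
  have := @marked_short_vector R K d sigma dimK sigma_inj (1 + m)
    (fun s => flow n.+1%:R (f_ s (x s))) (rho * eta ^+ d) rho _ (1 + m) x
    (flow_covol n.+1%:R) v (fun=> delta) (fun L => erefl) eps_rho mx v0 v_int
    (fun=> ltW delta0).
  rewrite prodr_const card_ord -/B => short.
  move: delta_lt; apply/negP; rewrite -leNgt; apply: short => s l.
  by rewrite -f_row; exact: vle.
have /choice[F FP] := small.
have mF k : measurable (F k) by have [] := FP k.
exists (\bigcap_k F k); split.
- exact: bigcapT_measurable.
- have muFk k : (mu (\bigcap_k F k) <= k.+1%:R^-1%:E * mu (ball x0 r))%E.
    have [_ _ /(le_trans _)] := FP k; apply; apply: le_measure; rewrite ?inE//.
      exact: bigcapT_measurable.
    by move=> x; apply.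
  have BE : mu (ball x0 r) = (fine (mu (ball x0 r)))%:E by rewrite fineK// ge0_fin_numE.
  rewrite BE in muFk; set b := fine _ in muFk.
  have b0 : 0 <= b by apply: fine_ge0; exact: measure_ge0.
  apply/eqP; rewrite eq_le measure_ge0 andbT; apply/lee_addgt0Pr => e e0.
  rewrite add0e; apply: le_trans (muFk (Num.bound (b / e))) _.
  rewrite -EFinM lee_fin ler_pdivrMl// mulrC -ler_pdivrMl// mulrC.
  apply: le_trans (ltW (archi_boundP _)) _; first by rewrite divr_ge0// ltW.
  by rewrite ler_nat.
- by move=> x xS k _; have [_ + _] := FP k; apply.
Qed.

End singular_on_support.

Theorem theorem2p3 (R : realType) (K : fieldExtType rat) (d : nat)
    (sigma : 'I_d -> {rmorphism K -> R})
    (dimK : \dim {:K} = d) (Kreal : totally_real R K)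
    (sigma_enum : enum_real_embeddings sigma)
    (m : nat) (m_ge1 : (1 <= m)%N)
    (X : 'I_d -> pmetricType R)
    (mu_ : forall s, {measure set borel (X s) -> \bar R})
    (mu : {measure set borel (sup_prod X) -> \bar R})
    (f_ : forall s, X s -> 'rV[R]_m) (f : sup_prod X -> 'M[R]_(d, m)) :
  besicovitch (sup_prod X) ->
  is_product_measure mu_ mu ->
  federer mu ->
  (forall x s, row s (f x) = f_ s (x s)) ->
  continuous f ->
  {ae mu, forall x, nonplanar_at mu_ f_ x} ->
  (forall s, {ae mu_ s, forall y, good_at (f_ s) (mu_ s) y}) ->
  pushforward mu (f : borel (sup_prod X) -> borel 'M[R]_(d, m))
    (Sing sigma) = 0%E.
Proof.
move=> bes mu_prod [mu_radon [Z1 [mZ1 Z10 fedZ]]] f_row fc [Z2 [mZ2 Z20 npZ]] good.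
have sigma_inj := sigma_enum.1.
have /all_sig[Z ZP] : forall s, {Z : set (borel (X s)) | [/\ measurable Z,
    mu_ s Z = 0%E & (~` [set y | good_at (f_ s) (mu_ s) y]) `<=` Z]}.
  by move=> s; apply: cid; exact: good.
pose A : set (borel (sup_prod X)) := f @^-1` Sing sigma.
have mA : measurable A by exact: measurable_preimage_Sing.
have mS : measurable (supp mu : set (borel (sup_prod X))).
  exact: measurable_supp.
have nZ s : mu.-negligible [set x : sup_prod X | Z s (x s)].
  have [mZ Z0 _] := ZP s; apply/negligibleP; first exact: measurable_cylinder.
  exact (measure_cylinder0 mu_prod mZ Z0).
(* [N] contains the points off the support and those where the Federer, nonplanarity or goodness
   condition fails. *)
pose N := ~` supp mu `|`
  (Z1 `|` (Z2 `|` \big[setU/set0]_(s < d) [set x : sup_prod X | Z s (x s)])).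
have [N' [mN' N'0 NN']] : mu.-negligible N.
  apply: negligibleU.
    by apply/negligibleP; [exact: measurableC|exact: measure_supp_setC].
  apply: negligibleU; first exact/negligibleP.
  apply: negligibleU; first exact/negligibleP.
  elim: (index_enum _) => [|s r IH]; first by rewrite big_nil; exact: negligible_set0.
  by rewrite big_cons; apply: negligibleU.
change (mu A = 0%E); apply/negligibleP => //.
(* At the points of [A] outside [N'] all local hypotheses hold, so singular points have measure 0
   near each of them, and [radon_null] makes this global. *)
apply: (negligibleS (A := (A `\` N') `|` N')).
  by move=> x Ax; have [N'x|N'x] := pselect (N' x); [right|left].
apply: negligibleU.
- apply/negligibleP; first exact: measurableD.
  apply: radon_null => // [|x [Ax N'x]]; first exact: measurableD.
  have Nx : ~ N x by move=> /NN'.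
  have xs : supp mu x by apply: contrapT => ?; apply: Nx; left.
  have [||||W xW [E [mE E0 WE]]] := @local_singular_null R K d sigma dimK sigma_inj m X
    mu_ mu f_ f bes mu_prod f_row fc x xs.
  + by have [] := mu_radon; exact.
  + by apply: contrapT => nfed; apply: Nx; right; left; exact: fedZ.
  + by apply: contrapT => nnp; apply: Nx; right; right; left; exact: npZ.
  + move=> s; apply: contrapT => ng; apply: Nx; right; right; right.
    rewrite -bigcup_seq; exists s; first by rewrite /= mem_index_enum.
    by have [_ _] := ZP s; apply.
  exists W => //; exists E; split=> // y [[Ay N'y] Wy]; apply: WE; split=> //; split=> //.
  by apply: contrapT => ys; apply: N'y; apply: NN'; left.
- exact/negligibleP.
Qed.
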